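(* Let $\mathcal{M}=(R,S,M,N,\varphi,\psi)$ be a Morita context and let $\Lambda(\mathcal{M})=\left(\begin{smallmatrix} R & M\\ N & S\end{smallmatrix}\right)$ be its Morita context ring. Suppose that $\Lambda(\mathcal{M})$ is semiprimary. Assume that the following four conditions are satisfied. (a) $R/\operatorname{Im}\varphi$ and $S$ are quasi-hereditary rings. (b) $M$ is a projective (right) $S$-module. (c) $N$ is a projective $S^{\mathrm{op}}$-module (i.e. a projective left $S$-module). (d) $\varphi$ is a monomorphism. Then $\Lambda(\mathcal{M})$ is a quasi-hereditary ring.
   Context: All rings are associative and unital; modules are right modules unless otherwise stated, and $R^{\mathrm{op}}$-modules are left $R$-modules. $J(R)$ denotes the Jacobson radical of $R$. A ring $R$ is semiprimary if $J(R)$ is nilpotent and $R/J(R)$ is a semisimple (artinian) ring. A two-sided ideal $I$ of $R$ is an idempotent ideal if $I^2=I$. An idempotent ideal $H$ of $R$ is a heredity ideal if $H$ is a projective (right) $R$-module and $HJ(R)H=0$. A semiprimary ring $R$ is quasi-hereditary if it admits a heredity chain, i.e. a chain of two-sided ideals $R=H_0\supseteq H_1\supseteq\cdots\supseteq H_{m-1}\supseteq H_m=0$ such that $H_i/H_{i+1}$ is a heredity ideal of $R/H_{i+1}$ for each $0\le i\le m-1$. A Morita context is a $6$-tuple $(R,S,M,N,\varphi,\psi)$ where $R,S$ are rings, $M$ is an $R$-$S$-bimodule, $N$ is an $S$-$R$-bimodule, $\varphi:M\otimes_S N\to R$ is an $R$-$R$-bimodule homomorphism and $\psi:N\otimes_R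 M\to S$ is an $S$-$S$-bimodule homomorphism such that $\varphi(m\otimes n)m'=m\psi(n\otimes m')$ and $\psi(n\otimes m)n'=n\varphi(m\otimes n')$ for all $m,m'\in M$, $n,n'\in N$. Its Morita context ring $\Lambda(\mathcal{M})$ is the set of matrices $\left(\begin{smallmatrix} r&m\\ n&s\end{smallmatrix}\right)$ with $r\in R$, $m\in M$, $n\in N$, $s\in S$, with entrywise addition and multiplication $$\begin{pmatrix} r&m\\ n&s\end{pmatrix}\begin{pmatrix} r'&m'\\ n'&s'\end{pmatrix}=\begin{pmatrix} rr'+\varphi(m\otimes n') & rm'+ms'\\ nr'+sn' & \psi(n\otimes m')+ss'\end{pmatrix}.$$ *)

(* Defs.v *)
From HB Require Import structures.
From mathcomp Require Import all_boot all_algebra.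
From mathcomp Require Import boolp.
From mathcomp.multinomials Require Import freeg.

Set Implicit Arguments.
Unset Strict Implicit.
Unset Printing Implicit Defensive.

Import GRing.Theory.
Local Open Scope ring_scope.
Local Open Scope quotient_scope.

(* Rings are [pzRingType]s: associative, unital, possibly zero (the quotients
   [R / Im phi] below may vanish).  A left [R]-module is an [lmodType R]; a right
   [R]-module is an [lmodType R^c], where [R^c] is the opposite ring, so that
   [a *: x] stands for [x a].  In particular [R^c^o] is the regular right
   module [R_R].  Subsets are boolean predicates, [`[< P >]] being the classical
   truth value of a proposition [P]. *)

Reserved Notation "x *' s" (at level 40, left associativity).

Section Submodule.
Variables (R : pzRingType) (V : lmodType R) (N : submodClosed V).

Definition submod : Type := {x : V | x \in N}.

HB.instance Definition _ := SubChoice.on submod.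
HB.instance Definition _ := [SubChoice_isSubLmodule of submod by <:].

End Submodule.

Definition projective_mod (R : pzRingType) (P : lmodType R) : Prop :=
  forall (U V : lmodType R) (g : {linear U -> V}) (f : {linear P -> V}),
    (forall v, exists u, g u = v) ->
  exists h : {linear P -> U}, forall x, g (h x) = f x.

Definition semisimple_mod (R : pzRingType) (V : lmodType R) : Prop :=
  forall N : submodClosed V, exists N' : submodClosed V,
    (forall v, exists2 x, x \in N & exists2 y, y \in N' & v = x + y) /\
    (forall x, x \in N -> x \in N' -> x = 0).

Definition maximal_submod (R : pzRingType) (V : lmodType R)
    (N : submodClosed V) : Prop :=
  (exists v, v \notin N) /\
  forall K : submodClosed V, {subset N <= K} ->
    (exists v, v \notin K) -> {subset K <= N}.

Definition two_sided (A : pzRingType) (I : {pred A}) : Prop :=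
  forall a x, x \in I -> (a * x \in I) /\ (x * a \in I).

HB.mixin Record isTwoSided (A : pzRingType) (I : A -> bool) := {
  two_sided_subproof : two_sided I
}.

#[short(type="tsideal")]
HB.structure Definition TwoSidedIdeal (A : pzRingType) :=
  {I of GRing.ZmodClosed A I & isTwoSided A I}.

Lemma idealMl (A : pzRingType) (I : tsideal A) a x : x \in I -> a * x \in I.
Proof. by case/(two_sided_subproof (s := I) a). Qed.

Lemma idealMr (A : pzRingType) (I : tsideal A) a x : x \in I -> x * a \in I.
Proof. by case/(two_sided_subproof (s := I) a). Qed.

Definition as_right_ideal (A : pzRingType) (I : {pred A}) : {pred A^c^o} := I.

Section RightIdeal.
Variables (A : pzRingType) (I : tsideal A).

Lemma as_right_ideal_closed : submod_closed (as_right_ideal I).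
Proof.
split=> [|a u v uI vI]; first exact: (rpred0 I).
by apply: (@rpredD _ I) => //; exact: (@idealMr _ I).
Qed.

HB.instance Definition _ :=
  GRing.isSubmodClosed.Build A^c A^c^o (as_right_ideal I) as_right_ideal_closed.

End RightIdeal.

Definition quot_ring (A : pzRingType) (I : tsideal A) : Type :=
  Quotient.quot (I : zmodClosed A).

Section QuotRing.
Variables (A : pzRingType) (I : tsideal A).
Local Notation Q := (quot_ring I).

HB.instance Definition _ := ZmodQuotient.on Q.

Definition quot_one : Q := lift_cst Q 1.
Definition quot_mul : Q -> Q -> Q := lift_op2 Q *%R.

Canonical pi_quot_one_morph := PiConst quot_one.

Lemma pi_quot_mul : {morph \pi : x y / x * y >-> quot_mul x y}.
Proof.
move=> x y; unlock quot_mul; apply/eqP; rewrite -Quotient.idealrBE.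
rewrite -[x * y](addrNK (x * repr (\pi_Q y))) -mulrBr -addrA -mulrBl.
rewrite rpredD //.
  by apply: (@idealMl _ I); rewrite Quotient.idealrBE reprK.
by apply: (@idealMr _ I); rewrite Quotient.idealrBE reprK.
Qed.
Canonical pi_quot_mul_morph := PiMorph2 pi_quot_mul.

Lemma quot_mulA : associative quot_mul.
Proof. by move=> x y z; rewrite -[x]reprK -[y]reprK -[z]reprK !piE mulrA. Qed.

Lemma quot_mul1l : left_id quot_one quot_mul.
Proof. by move=> x; rewrite -[x]reprK !piE mul1r. Qed.

Lemma quot_mul1r : right_id quot_one quot_mul.
Proof. by move=> x; rewrite -[x]reprK !piE mulr1. Qed.

Lemma quot_mulDl : left_distributive quot_mul +%R.
Proof. by move=> x y z; rewrite -[x]reprK -[y]reprK -[z]reprK !piE mulrDl. Qed.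

Lemma quot_mulDr : right_distributive quot_mul +%R.
Proof. by move=> x y z; rewrite -[x]reprK -[y]reprK -[z]reprK !piE mulrDr. Qed.

HB.instance Definition _ := GRing.Zmodule_isPzRing.Build Q
  quot_mulA quot_mul1l quot_mul1r quot_mulDl quot_mulDr.

Definition quot_map (x : A) : Q := \pi x.

Lemma quot_map_is_zmod_morphism : zmod_morphism quot_map.
Proof. by move=> x y; rewrite /quot_map !piE. Qed.

Lemma quot_map_is_monoid_morphism : monoid_morphism quot_map.
Proof. by split=> [|x y]; rewrite /quot_map !piE. Qed.

HB.instance Definition _ :=
  GRing.isZmodMorphism.Build A Q quot_map quot_map_is_zmod_morphism.
HB.instance Definition _ :=
  GRing.isMonoidMorphism.Build A Q quot_map quot_map_is_monoid_morphism.

Lemma quot_map_surj (q : Q) : exists x, quot_map x = q.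
Proof. by exists (repr q); rewrite /quot_map reprK. Qed.

Lemma quot_map_eq0 x : (quot_map x == 0) = (x \in I).
Proof.
by rewrite -[x in RHS]subr0 Quotient.idealrBE -[0 in LHS](rmorph0 (@quot_map)).
Qed.

End QuotRing.

Arguments quot_map {A} I x.

(* The additive subgroup generated by the products [x * y], [x \in I], [y \in J]. *)
Definition ideal_mul (A : pzRingType) (I J : {pred A}) : {pred A} :=
  fun z => `[< exists2 s : seq (A * A),
                 (forall p, p \in s -> (p.1 \in I) && (p.2 \in J)) &
                 z = \sum_(p <- s) p.1 * p.2 >].

Definition ideal_exp (A : pzRingType) (I : {pred A}) (n : nat) : {pred A} :=
  iter n (ideal_mul I) predT.

Definition jacobson (A : pzRingType) : {pred A} :=
  fun x => `[< forall N : submodClosed A^c^o, maximal_submod N -> x \in N >].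

Section Jacobson.
Variable A : pzRingType.

Lemma jacobson_zmod_closed : zmod_closed (@jacobson A).
Proof.
split=> [|x y /asboolP xJ /asboolP yJ]; apply/asboolP => N maxN.
  exact: (rpred0 N).
have -> : x - y = x + y * -1 by rewrite mulrN1.
apply: (@rpredD A^c^o N); first exact: xJ.
by apply: (@rpredZ A^c A^c^o N (-1)); apply: yJ.
Qed.

Lemma jacobson_two_sided : two_sided (@jacobson A).
Proof.
move=> a x /asboolP xJ; split; apply/asboolP => N maxN; last first.
  by apply: (@rpredZ A^c A^c^o N a x); apply: xJ.
have [aN|aN] := boolP (a \in N); first exact: (@rpredZ A^c A^c^o N x a).
pose L : {pred A^c^o} := fun y => (a * (y : A) : A) \in N.
have Lclosed : submod_closed L.
  split=> [|b u v uL vL]; rewrite unfold_in /L /=.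
    by rewrite mulr0; apply: (rpred0 N).
  rewrite mulrDr mulrA; apply: (@rpredD A^c^o N) => //.
  exact: (@rpredZ A^c A^c^o N b (a * u)).
pose Lsub : submodClosed A^c^o :=
  HB.pack L (GRing.isSubmodClosed.Build A^c A^c^o L Lclosed).
apply: (xJ Lsub); split.
  by exists 1; rewrite unfold_in /= /L mulr1.
move=> K LK [w wK] k kK; apply: contraT => kL.
pose T : {pred A^c^o} :=
  fun z => `[< exists2 m : A^c^o, m \in N & exists b : A, z = m + (a * ((k : A) * b) : A) >].
have Tclosed : submod_closed T.
  split=> [|c u v /asboolP[m mN [b ->]] /asboolP[m' m'N [b' ->]]]; apply/asboolP.
    by exists 0; [exact: (rpred0 N) | exists 0; rewrite !mulr0 addr0].
  exists (c *: m + m'); first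
    exact: (@rpredD A^c^o N _ _ (@rpredZ A^c A^c^o N c m mN)).
  exists (b * c + b'); rewrite scalerDr.
  have -> : c *: ((a * ((k : A) * b) : A) : A^c^o)
      = (a * ((k : A) * (b * c)) : A) by rewrite !(@mulrA A).
  by rewrite !(@mulrDr A) addrACA.
pose Tsub : submodClosed A^c^o :=
  HB.pack T (GRing.isSubmodClosed.Build A^c A^c^o T Tclosed).
have T1 : (1 : A) \in T.
  apply: contraT => T1; have [_ /(_ Tsub) subTN] := maxN.
  suff : (a * (k : A) : A) \in N by move/negP: kL.
  apply: subTN.
  - by move=> m mN; apply/asboolP; exists m => //; exists 0; rewrite !mulr0 addr0.
  - by exists 1.
  apply/asboolP; exists 0; first exact: (rpred0 N).
  by exists 1; rewrite mulr1 add0r.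
have Ta : (a : A) \in T by rewrite -[a]mul1r; apply: (@rpredZ A^c A^c^o Tsub a 1).
have /asboolP[m mN [b ab]] := Ta.
have L1 : (1 - (k : A) * b : A) \in L.
  by rewrite unfold_in /L mulrBr mulr1 {1}ab addrK.
have K1 : (1 : A^c^o) \in K.
  rewrite -[1](subrK ((k : A) * b : A)); apply: (@rpredD A^c^o K); first exact: LK.
  exact: (@rpredZ A^c A^c^o K b k).
by case/negP: wK; rewrite -[w](@mul1r A); apply: (@rpredZ A^c A^c^o K w 1 K1).
Qed.

HB.instance Definition _ :=
  GRing.isZmodClosed.Build A (@jacobson A) jacobson_zmod_closed.
HB.instance Definition _ :=
  isTwoSided.Build A (@jacobson A) jacobson_two_sided.

End Jacobson.

Definition semisimple_ring (A : pzRingType) : Prop := semisimple_mod A^c^o.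

Definition semiprimary (A : pzRingType) : Prop :=
  (exists n, ideal_exp (@jacobson A) n =i pred1 0) /\
  semisimple_ring (quot_ring (@jacobson A)).

Definition heredity_ideal (A : pzRingType) (H : tsideal A) : Prop :=
  [/\ ideal_mul H H =i H,
      projective_mod (submod (as_right_ideal H : submodClosed A^c^o)) &
      ideal_mul (ideal_mul H (@jacobson A)) H =i pred1 0].

(* The image [(H + I) / I] of [H] in [A / I]; this is [H / I] when [I] is
   contained in [H]. *)
Definition quot_ideal (A : pzRingType) (I H : tsideal A) : {pred quot_ring I} :=
  fun q => `[< exists2 h, h \in H & q = quot_map I h >].
Arguments quot_ideal {A} I H q.

Section QuotIdeal.
Variables (A : pzRingType) (I H : tsideal A).

Lemma quot_ideal_zmod_closed : zmod_closed (quot_ideal I H).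
Proof.
split=> [|_ _ /asboolP[x xH ->] /asboolP[y yH ->]]; apply/asboolP.
  by exists 0; rewrite ?rmorph0 //; exact: (rpred0 H).
by exists (x - y); [exact: (@rpredB _ H) | rewrite rmorphB].
Qed.

Lemma quot_ideal_two_sided : two_sided (quot_ideal I H).
Proof.
move=> q _ /asboolP[x xH ->]; have [a <-] := quot_map_surj q.
split; apply/asboolP; rewrite -rmorphM.
  by exists (a * x) => //; apply: (@idealMl _ H).
by exists (x * a) => //; apply: (@idealMr _ H).
Qed.

HB.instance Definition _ :=
  GRing.isZmodClosed.Build (quot_ring I) (quot_ideal I H) quot_ideal_zmod_closed.
HB.instance Definition _ :=
  isTwoSided.Build (quot_ring I) (quot_ideal I H) quot_ideal_two_sided.

End QuotIdeal.

Definition heredity_chain (A : pzRingType) (m : nat) (H : nat -> tsideal A) : Prop :=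
  [/\ H 0 =i predT, H m =i pred1 0 &
      forall i, (i < m)%N ->
        {subset H i.+1 <= H i} /\ heredity_ideal (quot_ideal (H i.+1) (H i))].

Definition quasi_hereditary (A : pzRingType) : Prop :=
  semiprimary A /\ exists m (H : nat -> tsideal A), heredity_chain m H.

HB.mixin Record Lmodule_isBimodule (R S : pzRingType) V of GRing.Lmodule R V := {
  ract : V -> S -> V;
  ractA : forall x s t, ract (ract x s) t = ract x (s * t);
  ract1 : forall x, ract x 1 = x;
  ractDl : forall s, {morph ract^~ s : x y / x + y};
  ractDr : forall x, {morph ract x : s t / s + t};
  ractZ : forall r x s, ract (r *: x) s = r *: ract x s
}.

#[short(type="bimodType")]
HB.structure Definition Bimodule (R S : pzRingType) :=
  {V of GRing.Lmodule R V & Lmodule_isBimodule R S V}.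

Notation "x *' s" := (ract x s) : ring_scope.

Definition rmod (R S : pzRingType) (M : bimodType R S) : Type := M.

Section RightModule.
Variables (R S : pzRingType) (M : bimodType R S).

HB.instance Definition _ := GRing.Zmodule.on (rmod M).

Let rscale (s : S^c) (x : rmod M) : rmod M := (x : M) *' s.

Fact rscaleA s t x : rscale s (rscale t x) = rscale (s * t) x.
Proof. exact: ractA. Qed.

Fact rscale1 : left_id 1 rscale. Proof. exact: ract1. Qed.

Fact rscaleDr : right_distributive rscale +%R.
Proof. by move=> s x y; apply: ractDl. Qed.

Fact rscaleDl x : {morph rscale^~ x : s t / s + t}.
Proof. by move=> s t; apply: ractDr. Qed.

HB.instance Definition _ := GRing.Zmodule_isLmodule.Build S^c (rmod M)
  rscaleA rscale1 rscaleDr rscaleDl.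

End RightModule.

HB.instance Definition _ (R : pzRingType) :=
  Lmodule_isBimodule.Build R R R^o
    (fun x s t => esym (mulrA x s t)) (@mulr1 R)
    (fun s x y => mulrDl x y s) (@mulrDr R)
    (fun r x s => esym (mulrA r x s)).

Record bimod_hom (R S : pzRingType) (U V : bimodType R S) := BimodHom {
  bimod_fun :> {linear U -> V};
  bimod_funP : forall x s, bimod_fun (x *' s) = bimod_fun x *' s
}.

Section Tensor.
Variables (R S Q : pzRingType) (M : bimodType R S) (N : bimodType S Q).

Local Notation free := {freeg (M * N)%type / int}.
Local Notation "<< m , n >>" := (<< (m, n) >> : free).

(* The least subgroup of the free abelian group on [M * N] that contains the
   relators of biadditivity and of [S]-balancedness. *)
Inductive tensor_rel : free -> Prop :=
| Tensor_rel0 : tensor_rel 0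
| Tensor_relB x y : tensor_rel x -> tensor_rel y -> tensor_rel (x - y)
| Tensor_relDl m m' n : tensor_rel (<<m + m', n>> - <<m, n>> - <<m', n>>)
| Tensor_relDr m n n' : tensor_rel (<<m, n + n'>> - <<m, n>> - <<m, n'>>)
| Tensor_relZ m s n : tensor_rel (<<m *' s, n>> - <<m, s *: n>>).

Definition tensor_ker : {pred free} := fun x => `[< tensor_rel x >].

Lemma tensor_ker_zmod_closed : zmod_closed tensor_ker.
Proof.
split=> [|x y /asboolP xK /asboolP yK]; apply/asboolP; first exact: Tensor_rel0.
exact: Tensor_relB.
Qed.

HB.instance Definition _ :=
  GRing.isZmodClosed.Build free tensor_ker tensor_ker_zmod_closed.

Definition tensor : Type := Quotient.quot tensor_ker.

HB.instance Definition _ := ZmodQuotient.on tensor.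

Lemma tensor_pi_eq x y : tensor_rel (x - y) <-> \pi_tensor x = \pi_tensor y.
Proof.
have E := Quotient.idealrBE tensor_ker x y.
split=> [xy|/eqP xy]; first by apply/eqP; apply: etrans (esym E) _; apply/asboolP.
by apply/asboolP; apply: etrans E xy.
Qed.

Lemma tensor_piD (x y : free) : \pi_tensor (x + y) = \pi_tensor x + \pi_tensor y.
Proof. by rewrite !piE. Qed.

Lemma tensor_piB (x y : free) : \pi_tensor (x - y) = \pi_tensor x - \pi_tensor y.
Proof. by rewrite !piE. Qed.

Definition tens (m : M) (n : N) : tensor := \pi_tensor <<m, n>>.

Lemma tensDl m m' n : tens (m + m') n = tens m n + tens m' n.
Proof.
by rewrite -tensor_piD; apply/tensor_pi_eq; rewrite opprD addrA;
  apply: Tensor_relDl.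
Qed.

Lemma tensDr m n n' : tens m (n + n') = tens m n + tens m n'.
Proof.
by rewrite -tensor_piD; apply/tensor_pi_eq; rewrite opprD addrA;
  apply: Tensor_relDr.
Qed.

Lemma tensZ m s n : tens (m *' s) n = tens m (s *: n).
Proof. by apply/tensor_pi_eq; apply: Tensor_relZ. Qed.

Lemma tensor_ind (P : tensor -> Prop) :
    P 0 -> (forall x y, P x -> P y -> P (x - y)) -> (forall m n, P (tens m n)) ->
  forall x, P x.
Proof.
move=> P0 PB Pt; elim/quotW=> x.
have PN y : P y -> P (- y) by rewrite -sub0r; apply: PB.
have PD y z : P y -> P z -> P (y + z).
  by move=> Py /PN Pz; rewrite -[z]opprK; apply: PB.
have pi0 : \pi_tensor (0 : free) = 0 by rewrite -(subrr 0) tensor_piB subrr.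
rewrite -[x]freeg_sumE; elim: (dom x) => [|[m n] s IHs].
  by rewrite big_nil pi0.
rewrite big_cons tensor_piD; apply: (PD) => //.
have Pn k : P (\pi_tensor (<<m, n>> *+ k)).
  elim: k => [|k IHk]; first by rewrite mulr0n pi0.
  by rewrite mulrS tensor_piD; apply: (PD) => //; apply: Pt.
rewrite -[coeff _ _]intz -freegU_mulz; case: (coeff _ _) => k; first exact: Pn.
by rewrite NegzE mulrNz -[- _]sub0r tensor_piB pi0 sub0r; apply/PN/Pn.
Qed.

Section Lift.
Variables (Z : zmodType) (f : M -> N -> Z).
Hypotheses (fDl : forall n, {morph f^~ n : m m' / m + m'})
  (fDr : forall m, {morph f m : n n' / n + n'})
  (fZ : forall m s n, f (m *' s) n = f m (s *: n)).

Let lift (x : free) : Z := fglift (fun p => f p.1 p.2 : zmodule Z) x.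

Let liftB x y : lift (x - y) = lift x - lift y.
Proof. exact: (@lift_is_additive _ _ (zmodule Z) _ x y). Qed.

Let liftE m n : lift <<m, n>> = f m n.
Proof. by rewrite /lift liftU scale1r. Qed.

Let lift_rel x : tensor_rel x -> lift x = 0.
Proof.
elim=> [|{}x y _ x0 _ y0|m m' n|m n n'|m s n].
- by have := liftB 0 0; rewrite !subrr.
- by rewrite liftB x0 y0 subrr.
- by rewrite !liftB !liftE fDl addrAC addrK subrr.
- by rewrite !liftB !liftE fDr addrAC addrK subrr.
- by rewrite liftB !liftE fZ subrr.
Qed.

Definition tensor_lift (x : tensor) : Z := lift (repr x).

Let tensor_lift_pi x : tensor_lift (\pi x) = lift x.
Proof.
apply/eqP; rewrite -subr_eq0 -liftB lift_rel //.
by apply/tensor_pi_eq; rewrite reprK.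
Qed.

Lemma tensor_lift_is_zmod_morphism : zmod_morphism tensor_lift.
Proof.
elim/quotW=> x; elim/quotW=> y.
by rewrite -tensor_piB !tensor_lift_pi liftB.
Qed.

Lemma tensor_lift_tens m n : tensor_lift (tens m n) = f m n.
Proof. by rewrite tensor_lift_pi liftE. Qed.

End Lift.

Definition tensor_lscale (r : R) : tensor -> tensor :=
  tensor_lift (fun m n => tens (r *: m) n).

Definition tensor_rscale (x : tensor) (q : Q) : tensor :=
  tensor_lift (fun m n => tens m (n *' q)) x.

Lemma tensor_lscale_zmod r : zmod_morphism (tensor_lscale r).
Proof.
apply: tensor_lift_is_zmod_morphism => [n m m'|m n n'|m s n].
- by rewrite scalerDr tensDl.
- by rewrite tensDr.
- by rewrite -ractZ tensZ.
Qed.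

Lemma tensor_lscaleE r m n : tensor_lscale r (tens m n) = tens (r *: m) n.
Proof.
apply: tensor_lift_tens => [{}n {}m m'|{}m {}n n'|{}m s {}n].
- by rewrite scalerDr tensDl.
- by rewrite tensDr.
- by rewrite -ractZ tensZ.
Qed.

Lemma tensor_rscale_zmod q : zmod_morphism (tensor_rscale^~ q).
Proof.
apply: tensor_lift_is_zmod_morphism => [n m m'|m n n'|m s n].
- by rewrite tensDl.
- by rewrite ractDl tensDr.
- by rewrite tensZ ractZ.
Qed.

Lemma tensor_rscaleE m n q : tensor_rscale (tens m n) q = tens m (n *' q).
Proof.
apply: (tensor_lift_tens (f := fun m n => tens m (n *' q)))
  => [{}n {}m m'|{}m {}n n'|{}m s {}n].
- by rewrite tensDl.
- by rewrite ractDl tensDr.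
- by rewrite tensZ ractZ.
Qed.

Lemma tensor_morph_ext (f g : tensor -> tensor) :
    zmod_morphism f -> zmod_morphism g ->
    (forall m n, f (tens m n) = g (tens m n)) ->
  f =1 g.
Proof.
move=> fB gB fg; elim/tensor_ind => // [|x y fgx fgy].
  by have := fB 0 0; have := gB 0 0; rewrite !subrr => -> ->.
by rewrite fB gB fgx fgy.
Qed.

End Tensor.

Section TensorBimodule.
Variables (R S Q : pzRingType) (M : bimodType R S) (N : bimodType S Q).
Local Notation T := (tensor M N).
Local Notation lscale := (@tensor_lscale R S Q M N).
Local Notation rscale := (@tensor_rscale R S Q M N).

Let comp_zmod (f g : T -> T) :
  zmod_morphism f -> zmod_morphism g -> zmod_morphism (f \o g).
Proof. by move=> fB gB x y; rewrite /= gB fB. Qed.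

Let add_zmod (f g : T -> T) :
  zmod_morphism f -> zmod_morphism g -> zmod_morphism (fun x => f x + g x).
Proof. by move=> fB gB x y; rewrite fB gB opprD addrACA. Qed.

Let morphD (f : T -> T) : zmod_morphism f -> {morph f : x y / x + y}.
Proof.
move=> fB x y; have f0 : f 0 = 0 by have := fB 0 0; rewrite !subrr.
by rewrite -{1}[y]opprK fB -[- y]sub0r fB f0 sub0r opprK.
Qed.

Fact tensor_lscaleA r r' x : lscale r (lscale r' x) = lscale (r * r') x.
Proof.
apply: (tensor_morph_ext (f := lscale r \o lscale r')) => [||m n] /=.
- by apply: comp_zmod; apply: tensor_lscale_zmod.
- exact: tensor_lscale_zmod.
- by rewrite !tensor_lscaleE scalerA.
Qed.

Fact tensor_lscale1 : left_id 1 lscale.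
Proof.
apply: (tensor_morph_ext (g := id)) => // [|m n]; first exact: tensor_lscale_zmod.
by rewrite tensor_lscaleE scale1r.
Qed.

Fact tensor_lscaleDr : right_distributive lscale +%R.
Proof. by move=> r; apply: morphD; apply: tensor_lscale_zmod. Qed.

Fact tensor_lscaleDl x : {morph lscale^~ x : r r' / r + r'}.
Proof.
move=> r r'; apply: (tensor_morph_ext (g := fun x => lscale r x + lscale r' x)).
- exact: tensor_lscale_zmod.
- by apply: add_zmod; apply: tensor_lscale_zmod.
- by move=> m n; rewrite !tensor_lscaleE scalerDl tensDl.
Qed.

HB.instance Definition _ := GRing.Zmodule_isLmodule.Build R T
  tensor_lscaleA tensor_lscale1 tensor_lscaleDr tensor_lscaleDl.

Fact tensor_rscaleA x q q' : rscale (rscale x q) q' = rscale x (q * q').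
Proof.
apply: (tensor_morph_ext (f := rscale^~ q' \o rscale^~ q)
  (g := rscale^~ (q * q'))) => [||m n] /=.
- by apply: comp_zmod; apply: tensor_rscale_zmod.
- exact: tensor_rscale_zmod.
- by rewrite !tensor_rscaleE ractA.
Qed.

Fact tensor_rscale1 x : rscale x 1 = x.
Proof.
apply: (tensor_morph_ext (f := rscale^~ 1) (g := id)) => // [|m n].
  exact: tensor_rscale_zmod.
by rewrite tensor_rscaleE ract1.
Qed.

Fact tensor_rscaleDl q : {morph rscale^~ q : x y / x + y}.
Proof. by apply: morphD; apply: tensor_rscale_zmod. Qed.

Fact tensor_rscaleDr x : {morph rscale x : q q' / q + q'}.
Proof.
move=> q q'; apply: (tensor_morph_ext (f := rscale^~ (q + q'))
  (g := fun x => rscale x q + rscale x q')).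
- exact: tensor_rscale_zmod.
- by apply: add_zmod; apply: tensor_rscale_zmod.
- by move=> m n; rewrite !tensor_rscaleE ractDr tensDr.
Qed.

Fact tensor_rscaleZ r x q : rscale (r *: x) q = r *: rscale x q.
Proof.
apply: (tensor_morph_ext (f := rscale^~ q \o lscale r)
  (g := lscale r \o rscale^~ q)) => [||m n] /=.
- by apply: comp_zmod; [apply: tensor_rscale_zmod | apply: tensor_lscale_zmod].
- by apply: comp_zmod; [apply: tensor_lscale_zmod | apply: tensor_rscale_zmod].
- by rewrite tensor_lscaleE !tensor_rscaleE tensor_lscaleE.
Qed.

HB.instance Definition _ := Lmodule_isBimodule.Build R Q T
  tensor_rscaleA tensor_rscale1 tensor_rscaleDl tensor_rscaleDr tensor_rscaleZ.

Lemma tens_lscaleE r m n : r *: (tens m n : T) = tens (r *: m) n.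
Proof. exact: tensor_lscaleE. Qed.

Lemma tens_rscaleE m n q : (tens m n : T) *' q = tens m (n *' q).
Proof. exact: tensor_rscaleE. Qed.

End TensorBimodule.

Record morita_context (R S : pzRingType) (M : bimodType R S) (N : bimodType S R) :=
  MoritaContext {
    mor_phi : bimod_hom (tensor M N) R^o;
    mor_psi : bimod_hom (tensor N M) S^o;
    mor_phiP : forall m n m', (mor_phi (tens m n) : R) *: m' =
                              m *' (mor_psi (tens n m') : S);
    mor_psiP : forall n m n', (mor_psi (tens n m) : S) *: n' =
                              n *' (mor_phi (tens m n') : R)
  }.

(* The matrix with rows [(r, m)] and [(n, s)] is the pair [((r, m), (n, s))]. *)
Definition morita_ring (R S : pzRingType) (M : bimodType R S) (N : bimodType S R)
  (C : morita_context M N) : Type := ((R * M) * (N * S))%type.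

Section MoritaRing.
Variables (R S : pzRingType) (M : bimodType R S) (N : bimodType S R).
Variable C : morita_context M N.
Local Notation L := (morita_ring C).

HB.instance Definition _ := GRing.Zmodule.on L.

Let phi (m : M) (n : N) : R := mor_phi C (tens m n).
Let psi (n : N) (m : M) : S := mor_psi C (tens n m).

Definition morita_one : L := ((1, 0), (0, 1)).

Definition morita_mul (x y : L) : L :=
  let: ((r, m), (n, s)) := x in
  let: ((r', m'), (n', s')) := y in
  ((r * r' + mor_phi C (tens m n'), r *: m' + m *' s'),
   (n *' r' + s *: n', mor_psi C (tens n m') + s * s')).

Let ract0l (A B : pzRingType) (V : bimodType A B) (b : B) : (0 : V) *' b = 0.
Proof. by apply: (addrI ((0 : V) *' b)); rewrite -ractDl !addr0. Qed.

Let ract0r (A B : pzRingType) (V : bimodType A B) (x : V) : x *' (0 : B) = 0.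
Proof. by apply: (addrI (x *' 0)); rewrite -ractDr !addr0. Qed.

Let phiDl m m' n : phi (m + m') n = phi m n + phi m' n.
Proof. by rewrite /phi tensDl raddfD. Qed.
Let phiDr m n n' : phi m (n + n') = phi m n + phi m n'.
Proof. by rewrite /phi tensDr raddfD. Qed.
Let psiDl n n' m : psi (n + n') m = psi n m + psi n' m.
Proof. by rewrite /psi tensDl raddfD. Qed.
Let psiDr n m m' : psi n (m + m') = psi n m + psi n m'.
Proof. by rewrite /psi tensDr raddfD. Qed.
Let phiZ m s n : phi (m *' s) n = phi m (s *: n).
Proof. by rewrite /phi tensZ. Qed.
Let psiZ n r m : psi (n *' r) m = psi n (r *: m).
Proof. by rewrite /psi tensZ. Qed.
Let phiMl r m n : phi (r *: m) n = r * phi m n.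
Proof. by rewrite /phi -tens_lscaleE linearZ. Qed.
Let phiMr m n r : phi m (n *' r) = phi m n * r.
Proof. by rewrite /phi -tens_rscaleE bimod_funP. Qed.
Let psiMl s n m : psi (s *: n) m = s * psi n m.
Proof. by rewrite /psi -tens_lscaleE linearZ. Qed.
Let psiMr n m s : psi n (m *' s) = psi n m * s.
Proof. by rewrite /psi -tens_rscaleE bimod_funP. Qed.
Let phi0l n : phi 0 n = 0.
Proof. by rewrite -[0](scale0r 0) phiMl mul0r. Qed.
Let phi0r m : phi m 0 = 0.
Proof. by rewrite -[0](ract0r 0) phiMr mulr0. Qed.
Let psi0l m : psi 0 m = 0.
Proof. by rewrite -[0](scale0r 0) psiMl mul0r. Qed.
Let psi0r n : psi n 0 = 0.
Proof. by rewrite -[0](ract0r 0) psiMr mulr0. Qed.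
Let phiP m n m' : phi m n *: m' = m *' psi n m'.
Proof. exact: mor_phiP. Qed.
Let psiP n m n' : psi n m *: n' = n *' phi m n'.
Proof. exact: mor_psiP. Qed.

Let mulE r m n s r' m' n' s' :
  morita_mul ((r, m), (n, s)) ((r', m'), (n', s')) =
  ((r * r' + phi m n', r *: m' + m *' s'), (n *' r' + s *: n', psi n m' + s * s')).
Proof. by []. Qed.

Let addE r m n s r' m' n' s' :
  (((r, m), (n, s)) : L) + ((r', m'), (n', s')) =
  ((r + r', m + m'), (n + n', s + s')).
Proof. by []. Qed.

Fact morita_mulA : associative morita_mul.
Proof.
move=> [[r1 m1] [n1 s1]] [[r2 m2] [n2 s2]] [[r3 m3] [n3 s3]].
rewrite !mulE; congr (_, _, (_, _)).
- rewrite mulrDr mulrDl phiDl phiDr mulrA phiMl phiMr phiZ.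
  by rewrite !addrA (addrAC _ _ (_ * r3)).
- rewrite scalerDr scalerDl ractDl ractDr scalerA !ractA ractZ phiP.
  by rewrite !addrA (addrAC _ _ (m1 *' psi _ _)).
- rewrite scalerDr scalerDl ractDl ractDr scalerA ractA ractZ psiP.
  by rewrite !addrA (addrAC _ _ (n1 *' phi _ _)).
- rewrite mulrDr mulrDl psiDl psiDr mulrA psiMl psiMr psiZ.
  rewrite -!addrA; congr (_ + _); rewrite [RHS]addrC -addrA.
  by congr (_ + _); rewrite addrC.
Qed.

Fact morita_mul1l : left_id morita_one morita_mul.
Proof.
move=> [[r m] [n s]]; rewrite mulE.
by rewrite !mul1r !scale1r phi0l psi0l !ract0l addr0 addr0 !add0r.
Qed.

Fact morita_mul1r : right_id morita_one morita_mul.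
Proof.
move=> [[r m] [n s]]; rewrite mulE.
by rewrite !mulr1 !ract1 phi0r psi0r !scaler0 !add0r !addr0.
Qed.

Fact morita_mulDl : left_distributive morita_mul +%R.
Proof.
move=> [[r1 m1] [n1 s1]] [[r2 m2] [n2 s2]] [[r3 m3] [n3 s3]].
rewrite addE !mulE addE !mulrDl !scalerDl !ractDl phiDl psiDl.
by congr (_, _, (_, _)); rewrite addrACA.
Qed.

Fact morita_mulDr : right_distributive morita_mul +%R.
Proof.
move=> [[r1 m1] [n1 s1]] [[r2 m2] [n2 s2]] [[r3 m3] [n3 s3]].
rewrite addE !mulE addE !mulrDr !scalerDr !ractDr phiDr psiDr.
by congr (_, _, (_, _)); rewrite addrACA.
Qed.

HB.instance Definition _ := GRing.Zmodule_isPzRing.Build L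
  morita_mulA morita_mul1l morita_mul1r morita_mulDl morita_mulDr.

End MoritaRing.

Definition im_phi (R S : pzRingType) (M : bimodType R S) (N : bimodType S R)
    (C : morita_context M N) : {pred R} :=
  fun r => `[< exists t, mor_phi C t = r >].

Section ImPhi.
Variables (R S : pzRingType) (M : bimodType R S) (N : bimodType S R).
Variable C : morita_context M N.

Fact im_phi_zmod_closed : zmod_closed (im_phi C).
Proof.
split=> [|_ _ /asboolP[x <-] /asboolP[y <-]]; apply/asboolP.
  by exists 0; rewrite raddf0.
by exists (x - y); rewrite raddfB.
Qed.

Fact im_phi_two_sided : two_sided (im_phi C).
Proof.
move=> a _ /asboolP[x <-]; split; apply/asboolP.
  by exists (a *: x); rewrite linearZ.
by exists (x *' a); rewrite bimod_funP.
Qed.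

HB.instance Definition _ :=
  GRing.isZmodClosed.Build R (im_phi C) im_phi_zmod_closed.
HB.instance Definition _ := isTwoSided.Build R (im_phi C) im_phi_two_sided.

End ImPhi.

(* Main.v *)
(** Let [e] be the idempotent of the Morita ring [L] with [eLe = S].  By (b) and
    (d), [LeL] is [Le] tensored over [S] with [eL], and the coordinates of a dual
    basis of [M] over [S] extend to right [L]-linear maps [LeL -> eL]; by (c), [eL]
    has a dual basis as a left [S]-module.  These two families of coordinates
    survive the passage to [L / LH'L] and [S / H'] for every ideal [H'] of [S].
    Composing them with the coordinates of a projective ideal [H] of [S] gives a
    dual basis of [LHL], so a heredity chain of [S] generates a chain from [LeL]
    down to [0] in [L]; above [LeL] one pulls back a chain of
    [L / LeL = R / Im phi].  Nothing is finitely generated here, so dual bases are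
    infinite, with coordinates of finite support. *)
From HB Require Import structures.
From mathcomp Require Import all_boot all_algebra.
From mathcomp Require Import boolp functions.
Require Import Defs.

Set Implicit Arguments.
Unset Strict Implicit.
Unset Printing Implicit Defensive.

Import GRing.Theory.
Local Open Scope ring_scope.

(** * Families of finite support and dual bases *)

Section FiniteSupport.
Variables (I : eqType) (V : zmodType).
Implicit Type G : I -> V.

Definition supported_in (s : seq I) G := forall i, i \notin s -> G i = 0.

Definition fin_supp G := exists s, supported_in s G.

(* Junk value 0 on a family of infinite support. *)
Definition fsum G : V :=
  if pselect (fin_supp G) is left fG then \sum_(i <- undup (projT1 (cid fG))) G i
  else 0.

Lemma eq_sum_supp s t G : uniq s -> uniq t ->
    supported_in s G -> supported_in t G ->
  \sum_(i <- s) G i = \sum_(i <- t) G i.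
Proof.
move=> us ut sG tG.
have E r : \sum_(i <- r) G i = \sum_(i <- [seq i <- r | G i != 0]) G i.
  rewrite big_filter [LHS](bigID (fun i => G i == 0)) /=.
  by rewrite big1 ?add0r // => i /eqP.
rewrite E [RHS]E; apply/perm_big/uniq_perm; rewrite ?filter_uniq // => i.
rewrite !mem_filter; have [//|Gi /=] := eqVneq (G i) 0.
have mem r : supported_in r G -> i \in r.
  by move=> rG; apply: contraNT Gi => /rG->.
by rewrite !mem.
Qed.

Lemma fsumE s G : supported_in s G -> fsum G = \sum_(i <- undup s) G i.
Proof.
move=> sG; rewrite /fsum; case: pselect => [fG|[]]; last by exists s.
case: cid => t /= tG; apply: eq_sum_supp; rewrite ?undup_uniq // => i.
  by rewrite mem_undup => /tG.
by rewrite mem_undup => /sG.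
Qed.

Lemma supported_cat s t G G' : supported_in s G -> supported_in t G' ->
  supported_in (s ++ t) G /\ supported_in (s ++ t) G'.
Proof.
by move=> sG tG; split=> i; rewrite mem_cat negb_or => /andP[/sG + /tG].
Qed.

Lemma fin_supp0 : fin_supp (fun=> 0).
Proof. by exists [::]. Qed.

Lemma fsumD G G' : fin_supp G -> fin_supp G' ->
  fsum (fun i => G i + G' i) = fsum G + fsum G'.
Proof.
move=> [s sG] [t tG]; have [stG stG'] := supported_cat sG tG.
rewrite (fsumE stG) (fsumE stG') -big_split /=; apply: fsumE => i i_st.
by rewrite stG ?stG' ?addr0.
Qed.

Lemma fsumB G G' : fin_supp G -> fin_supp G' ->
  fsum (fun i => G i - G' i) = fsum G - fsum G'.
Proof.
move=> [s sG] [t tG]; have [stG stG'] := supported_cat sG tG.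
rewrite (fsumE stG) (fsumE stG') -sumrB; apply: fsumE => i i_st.
by rewrite stG ?stG' ?subr0.
Qed.

Lemma fsum0 : fsum (fun=> 0) = 0.
Proof. by rewrite (@fsumE [::]) ?big_nil. Qed.

Lemma fsum1 i0 G : (forall i, i != i0 -> G i = 0) -> fsum G = G i0.
Proof.
move=> G0; rewrite (@fsumE [:: i0]) /= ?big_seq1 // => i.
by rewrite inE; apply: G0.
Qed.

Lemma eq_fsum G G' : G =1 G' -> fsum G = fsum G'.
Proof. by move=> /funext->. Qed.

End FiniteSupport.

Lemma fin_supp_map (I : eqType) (V W : zmodType) (h : I -> V -> W) (G : I -> V) :
  (forall i, h i 0 = 0) -> fin_supp G -> fin_supp (fun i => h i (G i)).
Proof. by move=> h0 [s sG]; exists s => i /sG->. Qed.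

Lemma raddf_fsum (I : eqType) (V W : zmodType) (h : V -> W) (G : I -> V) :
  zmod_morphism h -> fin_supp G -> fsum (fun i => h (G i)) = h (fsum G).
Proof.
move=> hB [s sG].
pose h' : {additive V -> W} := HB.pack h (GRing.isZmodMorphism.Build V W h hB).
rewrite (fsumE sG) -[h]/(h' : V -> W) raddf_sum (@fsumE _ _ s) // => i /sG->.
exact: raddf0.
Qed.

Lemma zmod_morphism0 (V W : zmodType) (h : V -> W) : zmod_morphism h -> h 0 = 0.
Proof. by move=> hB; rewrite -(subrr 0) hB subrr. Qed.

Lemma zmod_morphismD (V W : zmodType) (h : V -> W) :
  zmod_morphism h -> {morph h : x y / x + y}.
Proof.
move=> hB x y; rewrite -[y in LHS]opprK hB -[- y]sub0r hB.
by rewrite zmod_morphism0 // sub0r opprK.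
Qed.

Section MorphIn.
Variables (V W : zmodType) (D : zmodClosed V) (h : V -> W).
Hypothesis hB : {in D &, {morph h : x y / x - y}}.

(** The coordinates on an ideal used below are total functions on the ring, additive only on that
    ideal, so the usual facts on additive maps are restated relative to a subgroup. *)
Lemma morphB_in0 : h 0 = 0.
Proof. by rewrite -(subrr (0 : V)) hB ?rpred0 // subrr. Qed.

Lemma morphB_inD : {in D &, {morph h : x y / x + y}}.
Proof.
move=> x y xD yD; rewrite -[y in LHS]opprK hB ?rpredN //.
by rewrite -[- y]sub0r hB ?rpred0 // morphB_in0 sub0r opprK.
Qed.

End MorphIn.

Section FreeModule.
Variables (R : pzRingType) (P : lmodType R).

(** These functions form the free module with one generator for each element of [P]; [free_eval]
    sends the generator indexed by [k] to [k]. *)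
Definition fin_fun : {pred (P -> R^o)} := fun f => `[< fin_supp f >].

Fact fin_fun_closed : submod_closed fin_fun.
Proof.
split=> [|a f g /asboolP[s sf] /asboolP[t tg]]; apply/asboolP.
  exact: fin_supp0.
have [stf stg] := supported_cat sf tg; exists (s ++ t) => i i_st.
by rewrite addrfctE scalrfctE stf ?stg // scaler0 addr0.
Qed.

HB.instance Definition _ :=
  GRing.isSubmodClosed.Build R (P -> R^o) fin_fun fin_fun_closed.

Definition free_mod := submod (fin_fun : submodClosed (P -> R^o)).
HB.instance Definition _ := GRing.Lmodule.on free_mod.

Definition free_eval (f : free_mod) : P := fsum (fun k : P => (val f k : R) *: k).

Lemma free_fin_supp (f : free_mod) : fin_supp (fun k : P => (val f k : R) *: k).
Proof.
by case: f => f /= /asboolP[s sf]; exists s => k /sf->; rewrite scale0r.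
Qed.

Fact free_eval_linear : linear free_eval.
Proof.
move=> a f g; have fZ : fin_supp (fun k : P => a *: ((val f k : R) *: k)).
  by apply: (fin_supp_map (h := fun=> *:%R a)) (free_fin_supp f) => _; apply: scaler0.
rewrite /free_eval -(raddf_fsum (scalerBr a) (free_fin_supp f)).
rewrite -(fsumD fZ (free_fin_supp g)); apply: eq_fsum => k.
by rewrite /= addrfctE scalrfctE scalerDl scalerA.
Qed.

HB.instance Definition _ :=
  GRing.isLinear.Build R free_mod P _ free_eval free_eval_linear.

Lemma free_eval_surj v : exists f, free_eval f = v.
Proof.
pose d (k : P) : R^o := if k == v then 1 else 0.
have dP : d \in fin_fun.
  by apply/asboolP; exists [:: v] => k; rewrite inE /d => /negPf->.
exists (Sub d dP); rewrite /free_eval (fsum1 (i0 := v)) /= /d.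
  by rewrite eqxx scale1r.
by move=> k /negPf->; rewrite scale0r.
Qed.

End FreeModule.

(** Projectivity lifts the identity through [free_eval]; the entries of the resulting section are
    the coordinates, and the basis is [P] indexed by itself. *)
Lemma projective_dual_basis (R : pzRingType) (P : lmodType R) :
  projective_mod P -> exists c : P -> {scalar P},
    (forall x, fin_supp (c^~ x)) /\
    (forall x, fsum (fun k : P => c k x *: k) = x).
Proof.
move=> /(_ _ _ _ (idfun : {linear P -> P}) (@free_eval_surj R P))[h hK].
pose c k x : R := val (h x) k.
have cL k : scalar (c k).
  by move=> a x y; rewrite /c linearP /= addrfctE scalrfctE.
pose c' k : {scalar P} :=
  HB.pack (c k) (GRing.isLinear.Build R P R *%R (c k) (cL k)).
exists c'.
split=> x; last exact: hK.
by rewrite /= /c; case: (h x) => f /= /asboolP.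
Qed.

(** Choose preimages [u i] of the [f (b i)]: the finite sum of the [c i x *: u i] is linear in [x]
    and lifts [f]. *)
Lemma dual_basis_projective (R : pzRingType) (P : lmodType R) (I : eqType)
    (b : I -> P) (c : I -> {scalar P}) :
    (forall x, fin_supp (c^~ x)) ->
    (forall x, fsum (fun i => c i x *: b i) = x) ->
  projective_mod P.
Proof.
move=> cf cK U V g f g_surj.
have /choice[u gu] : forall i, exists u, g u = f (b i) by move=> i; apply: g_surj.
pose h x := fsum (fun i => c i x *: u i).
have cfZ x W (w : I -> W : lmodType R) : fin_supp (fun i => c i x *: w i).
  by apply: (fin_supp_map (h := fun i a => a *: w i)) (cf x) => i; apply: scale0r.
have hL : linear h.
  move=> a x y; rewrite /h -(raddf_fsum (scalerBr a)) // -fsumD //; last first.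
    apply: (fin_supp_map (h := fun i b => a *: (b *: u i))) (cf x) => i.
    by rewrite scale0r scaler0.
  by apply: eq_fsum => i; rewrite linearP scalerDl scalerA.
pose h' : {linear P -> U} := HB.pack h (GRing.isLinear.Build R P U _ h hL).
exists h' => x /=; rewrite -[in RHS](cK x) -!raddf_fsum //; [|exact: raddfB..].
by apply: eq_fsum => i; rewrite !linearZ gu.
Qed.

(** * Right ideals, radicals and ring isomorphisms *)

(** The coordinates are functions on all of [A], constrained only on [H], so that they can be
    composed and passed to quotients without a subtype. *)
Definition right_dual_basis (A : pzRingType) (H : {pred A}) (I : eqType)
    (b : I -> A) (F : I -> A -> A) : Prop :=
  [/\ forall i, b i \in H,
      forall i, {in H &, {morph F i : x y / x - y}},
      forall i x a, x \in H -> F i (x * a) = F i x * a,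
      forall x, x \in H -> fin_supp (F^~ x) &
      forall x, x \in H -> fsum (fun i => b i * F i x) = x].

Section RightIdealBasis.
Variables (A : pzRingType) (H : tsideal A).
Local Notation HA := (submod (as_right_ideal H : submodClosed A^c^o)).

Lemma fsum_val (I : eqType) (G : I -> HA) : fin_supp G ->
  fsum (fun i => val (G i) : A) = val (fsum G).
Proof. exact: (@raddf_fsum I HA A (val : HA -> A)). Qed.

Lemma projective_idealP :
  projective_mod HA <->
  exists (I : eqType) (b : I -> A) (F : I -> A -> A), right_dual_basis H b F.
Proof.
split=> [/projective_dual_basis[c [cf cK]]|[I [b [F [bH FB FM Ff FK]]]]].
  (* Outside [H] the coordinate takes the default value 0. *)
  pose F (k : HA) (x : A) : A := oapp (c k) 0 (insub x).
  have FE k x (xH : x \in as_right_ideal H) : F k x = c k (Sub x xH).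
    by rewrite /F insubT.
  exists HA, (fun k => val k), F; split=> [[k kH] //|k x y xH yH|k x a xH|x xH|x xH].
  - have xyH : x - y \in as_right_ideal H by apply: (@rpredB _ H).
    by rewrite !FE -(raddfB (c k)); congr (c k _); apply: val_inj.
  - have xaH : x * a \in as_right_ideal H by apply: (@idealMr _ H).
    rewrite !FE -[RHS]/((a : A^c) * _) -linearZ; congr (c k _); exact: val_inj.
  - by have [s sc] := cf (Sub x xH); exists s => k /sc; rewrite FE.
  transitivity (val (fsum (fun k : HA => c k (Sub x xH) *: k)) : A).
    rewrite -fsum_val => [|]; first by apply: eq_fsum => k; rewrite /= FE.
    apply: (fin_supp_map (h := fun (k : HA) a => a *: k)) (cf _) => k.
    exact: scale0r.
  by rewrite cK.
pose b' i : HA := Sub (b i) (bH i).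
pose c i (x : HA) : A^c := F i (val x).
have cL i : scalar (c i).
  move=> a u v; have uH : (val u : A) \in H := valP u.
  have vH : (val v : A) \in H := valP v.
  by have := morphB_inD (FB i) (@idealMr _ H (a : A) _ uH) vH; rewrite FM.
pose c' i : {scalar HA} :=
  HB.pack (c i) (GRing.isLinear.Build A^c HA A^c *%R (c i) (cL i)).
apply: (@dual_basis_projective _ HA I b' c').
- by move=> [x xH]; apply: Ff.
move=> [x xH]; apply: val_inj; rewrite -fsum_val /=; first exact: FK.
apply: (fin_supp_map (h := fun i (a : A^c) => a *: b' i)) (Ff _ xH) => i.
exact: scale0r.
Qed.

End RightIdealBasis.

Section IdealProduct.
Variable A : pzRingType.
Implicit Types I J : {pred A}.

Lemma mem_ideal_mul I J x y : x \in I -> y \in J -> x * y \in ideal_mul I J.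
Proof.
move=> xI yJ; apply/asboolP; exists [:: (x, y)]; last by rewrite big_seq1.
by move=> p; rewrite inE => /eqP->; rewrite xI.
Qed.

Lemma ideal_mul0 I J : 0 \in ideal_mul I J.
Proof. by apply/asboolP; exists [::]; rewrite ?big_nil. Qed.

Lemma ideal_mulD I J x y :
  x \in ideal_mul I J -> y \in ideal_mul I J -> x + y \in ideal_mul I J.
Proof.
move=> /asboolP[s sIJ ->] /asboolP[t tIJ ->]; apply/asboolP.
exists (s ++ t); last by rewrite big_cat.
by move=> p; rewrite mem_cat => /orP[/sIJ|/tIJ].
Qed.

Lemma ideal_mul_ind I J (P : A -> Prop) :
    P 0 -> (forall x y, P x -> P y -> P (x + y)) ->
    (forall x y, x \in I -> y \in J -> P (x * y)) ->
  forall z, z \in ideal_mul I J -> P z.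
Proof.
move=> P0 PD PM z /asboolP[s sIJ ->]; rewrite big_seq.
by apply: big_ind => // p /sIJ/andP[]; apply: PM.
Qed.

Lemma ideal_mul_eq0 I J :
  (forall x y, x \in I -> y \in J -> x * y = 0) -> ideal_mul I J =i pred1 0.
Proof.
move=> IJ0 z; rewrite inE; apply/idP/eqP => [|->]; last exact: ideal_mul0.
by apply: (ideal_mul_ind (P := fun z => z = 0)) => // x y -> ->; rewrite addr0.
Qed.

Lemma ideal_mul_sub (I J H : tsideal A) :
  {subset I <= H} -> {subset ideal_mul I J <= H}.
Proof.
move=> IH; apply: ideal_mul_ind => [|x y|x y /IH xH _]; first exact: (rpred0 H).
  exact: (@rpredD _ H).
exact: (@idealMr _ H).
Qed.

End IdealProduct.

Section RingIso.
Variables (A B : pzRingType) (f : {rmorphism A -> B}) (g : B -> A).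
Hypotheses (fK : cancel f g) (gK : cancel g f).

Let gB : {morph g : x y / x - y}.
Proof. by move=> x y; apply: (can_inj fK); rewrite rmorphB !gK. Qed.
Let gM : {morph g : x y / x * y}.
Proof. by move=> x y; apply: (can_inj fK); rewrite rmorphM !gK. Qed.

Let gD : {morph g : x y / x + y}.
Proof. by move=> x y; apply: (can_inj fK); rewrite rmorphD !gK. Qed.

(** The preimage [L] of a maximal right ideal [N] under [f] is maximal: a proper right ideal above
    [L] has as preimage under [g] a proper right ideal above [N]. *)
Lemma jacobson_iso x : x \in @jacobson A -> f x \in @jacobson B.
Proof.
move=> /asboolP xJ; apply/asboolP => N [[v vN] maxN].
pose L : {pred A^c^o} := fun a => (f a : B^c^o) \in N.
have Lcl : submod_closed L.
  split=> [|a u w uL wL]; rewrite unfold_in /L /=.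
    by rewrite rmorph0 (rpred0 N).
  rewrite rmorphD; apply: (@rpredD _ N) => //.
  by rewrite [f _]rmorphM; apply: (@rpredZ _ _ N (f a)).
pose L' : submodClosed A^c^o :=
  HB.pack L (GRing.isSubmodClosed.Build A^c A^c^o L Lcl).
apply: (xJ L'); split; first by exists (g v); rewrite unfold_in /= /L gK.
move=> K LK [w wK] k kK.
pose T : {pred B^c^o} := fun b => (g b : A^c^o) \in K.
have Tcl : submod_closed T.
  split=> [|b u t uT tT]; rewrite unfold_in /T /=.
    by rewrite -(subrr 0) gB subrr (rpred0 K).
  have -> : g (b *: u + t) = (g b : A^c) *: (g u : A^c^o) + g t :> A.
    by rewrite gD [g _]gM.
  by apply: (@rpredD _ K) => //; apply: rpredZ.
pose T' : submodClosed B^c^o :=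
  HB.pack T (GRing.isSubmodClosed.Build B^c B^c^o T Tcl).
apply: (maxN T'); last by rewrite unfold_in /= /T fK.
  by move=> b bN; apply: LK; rewrite unfold_in /= /L gK.
by exists (f w); rewrite unfold_in /= /T fK.
Qed.

(** Products and dual bases are carried back by [g]. The radical occurs only in a vanishing product,
    which injectivity of [f] and [jacobson_iso] reflect. *)
Lemma heredity_iso (I : tsideal A) (J : tsideal B) :
  (forall x, (x \in I) = (f x \in J)) -> heredity_ideal J -> heredity_ideal I.
Proof.
move=> IJ [J2 Jproj JJ0].
have gI y : y \in J -> g y \in I by rewrite IJ gK.
split=> [x| |].
- apply/idP/idP; first exact: ideal_mul_sub.
  rewrite IJ -J2 -{2}[x]fK; move: (f x); apply: ideal_mul_ind => [|x1 x2|y z yJ zJ].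
  + by rewrite -(subrr 0) gB subrr ideal_mul0.
  + by rewrite gD; apply: ideal_mulD.
  + by rewrite gM; apply: mem_ideal_mul; apply: gI.
- apply/projective_idealP.
  move: Jproj => /projective_idealP[K [b [F [bH FB FM Ff FK]]]].
  exists K, (fun i => g (b i)), (fun i x => g (F i (f x))).
  split=> [i|i x y|i x a|x|x]; rewrite ?IJ.
  + by rewrite gK.
  + by move=> xJ yJ; rewrite rmorphB FB ?gB.
  + by move=> xJ; rewrite rmorphM FM ?gM ?fK.
  + move=> xJ; apply: (fin_supp_map (h := fun=> g)) (Ff _ xJ) => i.
    exact: zmod_morphism0.
  move=> xJ; rewrite -{2}[x]fK -{2}(FK _ xJ) -raddf_fsum //; last first.
    apply: (fin_supp_map (h := fun i a => b i * a)) (Ff _ xJ) => i.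
    exact: mulr0.
  by apply: eq_fsum => i; rewrite gM.
apply: ideal_mul_eq0 => x y xIJ yI; apply: (can_inj fK); rewrite rmorphM rmorph0.
apply/eqP; rewrite -[_ == 0]/(_ \in pred1 0) -JJ0 mem_ideal_mul -?IJ //.
move: x xIJ; apply: ideal_mul_ind => [|u v|u v uI vJ].
- by rewrite rmorph0 ideal_mul0.
- by rewrite rmorphD; apply: ideal_mulD.
- by rewrite rmorphM mem_ideal_mul -?IJ // jacobson_iso.
Qed.

End RingIso.

Lemma heredity_ext (A : pzRingType) (I J : tsideal A) :
  I =i J -> heredity_ideal J -> heredity_ideal I.
Proof. by move=> IJ; apply: (@heredity_iso _ _ idfun id). Qed.

(** * Ideals generated by a corner *)

Section FiniteSupportPair.
Variables (I J : eqType) (V : zmodType) (G : I -> J -> V).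
Hypotheses (GI : exists s : seq I, forall i j, i \notin s -> G i j = 0)
  (GJ : forall i, fin_supp (G i)).

(** The support in [i] is uniform in [j], so only finitely many of the supports [t i] matter, and
    their union bounds [j]. *)
Let pair_supp : exists (s : seq I) (t : seq J), 
  (forall i j, i \notin s -> G i j = 0) /\
  (forall i j, i \in s -> j \notin t -> G i j = 0).
Proof.
have [s Gs] := GI; have /choice[t Gt] := GJ; exists s, (flatten (map t s)).
split=> // i j i_s jt; apply: (Gt); apply: contra jt => jt.
by apply/flattenP; exists (t i) => //; apply: map_f.
Qed.

Lemma fin_supp_pair : fin_supp (fun ij => G ij.1 ij.2).
Proof.
have [s [t [Gs Gt]]] := pair_supp.
exists [seq (i, j) | i <- s, j <- t] => -[i j] /=.
have [i_s|/Gs->//] := boolP (i \in s); have [j_t|/Gt->//] := boolP (j \in t).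
by rewrite allpairs_f.
Qed.

Lemma fsum_pair : fsum (fun ij => G ij.1 ij.2) = fsum (fun i => fsum (G i)).
Proof.
have [s [t [Gs Gt]]] := pair_supp.
rewrite (@fsumE _ _ s) => [|i i_s]; last first.
  by rewrite -[RHS](@fsum0 J); apply: eq_fsum => j; apply: Gs.
rewrite (@fsumE _ _ [seq (i, j) | i <- undup s, j <- undup t]) => [|[i j] /=].
  rewrite undup_id ?allpairs_uniq ?undup_uniq //; last by move=> [? ?] [].
  rewrite big_allpairs [LHS]big_seq [RHS]big_seq; apply: eq_bigr => i.
  by rewrite mem_undup => i_s; rewrite (@fsumE _ _ t) // => j; apply: Gt.
have [i_s|/Gs->//] := boolP (i \in s); have [j_t|/Gt->//] := boolP (j \in t).
by rewrite allpairs_f ?mem_undup.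
Qed.

End FiniteSupportPair.

(** This is [A iota(H) A]; for a multiplicative [iota] and [H] equal to [predT] it is the trace
    ideal [AeA], with [e = iota 1]. Signs are absorbed by the left factors. *)
Definition corner_ideal (A S : pzRingType) (iota : S -> A) (H : {pred S})
    : {pred A} :=
  fun z => `[< exists2 s : seq (A * S * A), (forall p, p \in s -> p.1.2 \in H) &
    z = \sum_(p <- s) p.1.1 * iota p.1.2 * p.2 >].

Section CornerIdeal.
Variables (A S : pzRingType) (iota : S -> A) (H : {pred S}).
Local Notation K := (corner_ideal iota H).

Lemma mem_corner_ideal a h b : h \in H -> a * iota h * b \in K.
Proof.
move=> hH; apply/asboolP; exists [:: (a, h, b)]; last by rewrite big_seq1.
by move=> p; rewrite inE => /eqP->.
Qed.

Fact corner_ideal_zmod_closed : zmod_closed K.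
Proof.
split=> [|_ _ /asboolP[s sH ->] /asboolP[t tH ->]]; apply/asboolP.
  by exists [::]; rewrite ?big_nil.
exists (s ++ [seq (- p.1.1, p.1.2, p.2) | p <- t]).
  by move=> p; rewrite mem_cat => /orP[/sH|/mapP[q /tH ? ->]].
rewrite big_cat big_map -sumrN; congr (_ + _); apply: eq_bigr => p _.
by rewrite !mulNr.
Qed.

HB.instance Definition _ := GRing.isZmodClosed.Build A K corner_ideal_zmod_closed.

(** The sum case also supplies both memberships, for use with maps that are additive only on the
    ideal. *)
Lemma corner_ideal_ind (P : A -> Prop) :
    P 0 -> (forall x y, x \in K -> y \in K -> P x -> P y -> P (x + y)) ->
    (forall a h b, h \in H -> P (a * iota h * b)) ->
  forall z, z \in K -> P z.
Proof.
move=> P0 PD PH z /asboolP[s sH ->]; rewrite big_seq.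
suff [] : \sum_(p <- s | p \in s) p.1.1 * iota p.1.2 * p.2 \in K /\
  P (\sum_(p <- s | p \in s) p.1.1 * iota p.1.2 * p.2) by [].
apply: (big_ind (fun z => z \in K /\ P z)) => [|x y [xK Px] [yK Py]|p /sH pH].
- by rewrite rpred0.
- by split; [apply: rpredD | apply: PD].
- by split; [apply: mem_corner_ideal | apply: PH].
Qed.

Fact corner_ideal_two_sided : two_sided K.
Proof.
move=> c; apply: corner_ideal_ind => [|x y _ _ [cx xc] [cy yc]|a h b hH].
- by rewrite mulr0 mul0r rpred0.
- by rewrite mulrDr mulrDl; split; apply: rpredD.
- by rewrite !mulrA -(mulrA _ b); split; apply: mem_corner_ideal.
Qed.

HB.instance Definition _ := isTwoSided.Build A K corner_ideal_two_sided.

End CornerIdeal.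

Lemma corner_idealS (A S : pzRingType) (iota : S -> A) (H H' : {pred S}) :
  {subset H <= H'} -> {subset corner_ideal iota H <= corner_ideal iota H'}.
Proof.
move=> HH'; apply: corner_ideal_ind => [|x y _ _|a h b /HH' hH'].
- exact: (rpred0 (corner_ideal iota H')).
- exact: (@rpredD _ (corner_ideal iota H')).
- exact: mem_corner_ideal.
Qed.

(* [iota] identifies [S] with the corner [eAe], [e = iota 1], and [rho a] is
   [e a e].  The last two fields hold when [eA] is projective as a left
   [S]-module and when [AeA] is the tensor product over [S] of [Ae], which is
   projective on the right, and [eA]. *)
Record stratifying (A S : pzRingType) (iota : S -> A) (rho : A -> S) : Prop := {
  iotaB : zmod_morphism iota;
  iotaM : {morph iota : s t / s * t};
  rhoB : zmod_morphism rho;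
  iotaK : cancel iota rho;
  rhoK : forall a, iota (rho a) = iota 1 * a * iota 1;
  corner_basis : exists (J : eqType) (y : J -> A) (g : J -> A -> S),
    [/\ forall j, zmod_morphism (g j),
        forall j s a, g j (iota s * a) = s * g j a,
        forall a, fin_supp (g^~ a) &
        forall a, fsum (fun j => iota (g j a) * y j) = iota 1 * a];
  trace_basis : exists (I : eqType) (x : I -> A) (F : I -> A -> A),
    right_dual_basis (corner_ideal iota predT) x F /\
    forall i k, k \in corner_ideal iota predT -> iota 1 * F i k = F i k
}.

(** * Heredity ideals generated from the corner *)

Section Stratifying.
Variables (A S : pzRingType) (iota : S -> A) (rho : A -> S).
Hypothesis AS : stratifying iota rho.
Local Notation e := (iota 1).
Local Notation K := (corner_ideal iota).

Let iB := iotaB AS.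
Let iM := iotaM AS.
Let iD := zmod_morphismD iB.
Let iI : injective iota := can_inj (iotaK AS).

Lemma iota_idem_l s : e * iota s = iota s. Proof. by rewrite -iM mul1r. Qed.
Lemma iota_idem_r s : iota s * e = iota s. Proof. by rewrite -iM mulr1. Qed.

Lemma rho_iota_l s a : rho (iota s * a) = s * rho a.
Proof.
by apply: iI; rewrite iM !(rhoK AS) !mulrA iota_idem_l iota_idem_r.
Qed.

Lemma iota_rho_iota a s : e * a * iota s = iota (rho a * s).
Proof. by rewrite iM (rhoK AS) -!mulrA iota_idem_l. Qed.

(** This is the inclusion of [e J(A) e] in [J(eAe)]: a maximal right ideal [N] of the corner yields
    the maximal right ideal [T] of [A], and taking [b = 1] returns to [N]. *)
Lemma jacobson_corner x : x \in @jacobson A -> rho x \in @jacobson S.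
Proof.
move=> /asboolP xJ; apply/asboolP => N [[w wN] maxN].
have rB := rhoB AS; have r0 := zmod_morphism0 rB.
have rD := zmod_morphismD rB.
have ND s t : s \in N -> t \in N -> (s : S) + t \in N by apply: (@rpredD _ N).
have NM (s t : S) : s \in N -> s * t \in N by apply: (@rpredZ S^c S^c^o N t).
pose T : {pred A^c^o} := fun a => `[< forall b : A, rho ((a : A) * b) \in N >].
have Tcl : submod_closed T.
  split=> [|c u v /asboolP uT /asboolP vT]; apply/asboolP => b.
    by rewrite mul0r r0 (rpred0 N).
  by rewrite mulrDl rD ND // -mulrA; apply: uT.
pose T' : submodClosed A^c^o :=
  HB.pack T (GRing.isSubmodClosed.Build A^c A^c^o T Tcl).
(* Maximality of [N] makes [T] maximal: if [rho (k b)] is not in [N], then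
   [k] and [T] together generate [1]. *)
suff /xJ/asboolP/(_ 1) : maximal_submod T' by rewrite mulr1.
split.
  exists (iota w); apply/asboolP => /(_ 1).
  by rewrite mulr1 (iotaK AS); apply/negP.
move=> U TU [v vU] k kU; apply/asboolP => b; apply: contraNT vU => kbN.
have UD a c : a \in U -> c \in U -> (a : A) + c \in U by apply: (@rpredD _ U).
have UM (a c : A) : a \in U -> a * c \in U by apply: (@rpredZ A^c A^c^o U c).
(* Since [e (1 - e) = 0], the complement [(1 - e)A] lies in [T]. *)
have U1e (a : A) : (1 - e) * a \in U.
  apply: TU; apply/asboolP => c; rewrite -mulrA mulrBl mul1r rB rho_iota_l.
  by rewrite mul1r subrr (rpred0 N).
have Ui s : s \in N -> iota s \in U.
  by move=> sN; apply: TU; apply/asboolP => c; rewrite rho_iota_l NM.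
(* [Q] is [N + rho (k * b) S]; it contains [N] properly, hence contains 1. *)
pose Q : {pred S^c^o} :=
  fun s => `[< exists2 n : S, n \in N & exists t : S, s = n + rho ((k : A) * b) * t >].
have Qcl : submod_closed Q.
  split=> [|c _ _ /asboolP[n nN [t ->]] /asboolP[n' nN' [t' ->]]]; apply/asboolP.
    by exists 0; [exact: (rpred0 N) | exists 0; rewrite mulr0 addr0].
  exists (n * (c : S) + n'); first by rewrite ND ?NM.
  exists (t * (c : S) + t'); rewrite mulrDr mulrA addrACA -mulrDl.
  by [].
pose Q' : submodClosed S^c^o :=
  HB.pack Q (GRing.isSubmodClosed.Build S^c S^c^o Q Qcl).
have /asboolP[n nN [t /(congr1 iota) e_nt]] : (1 : S) \in Q.
  apply: contraNT kbN => Q1; apply: (maxN Q').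
  - by move=> n nN; apply/asboolP; exists n => //; exists 0; rewrite mulr0 addr0.
  - by exists 1.
  by apply/asboolP; exists 0; [exact: (rpred0 N) | exists 1; rewrite mulr1 add0r].
have eU : e \in U.
  rewrite e_nt iD UD ?(Ui n) // iM UM // (rhoK AS).
  (* Modulo [(1 - e)A] the corner element agrees with [k * (b * e)], which lies in [U]. *)
  have -> : e * ((k : A) * b) * e = (k : A) * (b * e) + (1 - e) * - ((k : A) * b * e).
    by rewrite mulrN mulrBl mul1r opprB !mulrA addrC subrK.
  by apply: UD; [apply: UM | apply: U1e].
have U1 : (1 : A) \in U by rewrite -(subrK e 1) UD // -[1 - e]mulr1 U1e.
by rewrite -[v](@mul1r A) UM.
Qed.

Section Trace.
Variables (I : eqType) (x : I -> A) (F : I -> A -> A).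
Hypotheses (FP : right_dual_basis (K predT) x F)
  (eF : forall i k, k \in K predT -> e * F i k = F i k).

(** By right linearity only [F i (a * e)] matters; it lies in [eA], so multiplying it by [iota h] on
    the right lands in the corner. For [h] in [H] this puts the coordinates of [AHA] in
    [iota(H) A]. *)
Lemma trace_coord i a h b : F i (a * iota h * b) = iota (rho (F i (a * e)) * h) * b.
Proof.
have [_ _ FM _ _] := FP.
have ae : a * e \in K predT by rewrite -[_ * _]mulr1 mem_corner_ideal.
have -> : a * iota h * b = (a * e) * (iota h * b).
  by rewrite !mulrA -[a * e * iota h]mulrA iota_idem_l.
by rewrite FM // -{1}(eF i ae) !mulrA iota_rho_iota.
Qed.

End Trace.


(** For projectivity, each coordinate from [AeA] to [eA] restricts to a map from [AHA] to
    [iota(H) A], which is followed by a coordinate of [H] tensored with [eA]. The other two clauses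
    reduce to those of [H] inside the corner. *)
Lemma heredity_corner (H : tsideal S) : heredity_ideal H -> heredity_ideal (K H).
Proof.
move=> [H2 /projective_idealP[P [eta [alpha [etaH alB alM alf alK]]]] HJH0].
have subK : {subset K H <= K predT} by apply: corner_idealS.
split=> [z||]; last first.
- apply: ideal_mul_eq0 => z t; move: z.
  have E z h b : z \in ideal_mul (K H) (@jacobson A) -> h \in H ->
      z * iota h * b = 0.
    move=> zKJ hH; move: z zKJ b; apply: ideal_mul_ind => [|y z y0 z0|y j yK jJ] b.
    - by rewrite !mul0r.
    - by rewrite !mulrDl y0 z0 addr0.
    move: y yK j jJ; apply: corner_ideal_ind => [|y z _ _ y0 z0|a g c gH] j jJ.
    - by rewrite !mul0r.
    - by rewrite !mulrDl y0 // z0 // addr0.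
    (* Between two elements of [iota(H)] the factor [c * j] is seen only through [e * (c * j) * e],
       which lies in the radical of the corner. *)
    have rJ : rho (c * j) \in @jacobson S.
      by apply: jacobson_corner; apply: idealMl.
    have : g * rho (c * j) * h \in ideal_mul (ideal_mul H (@jacobson S)) H.
      by rewrite !mem_ideal_mul.
    rewrite HJH0 inE => /eqP/(congr1 iota); rewrite (zmod_morphism0 iB) !iM (rhoK AS).
    move=> E0; have -> : a * iota g * c * j * iota h * b =
      a * (iota g * (e * (c * j) * e) * iota h) * b.
      rewrite -!mulrA (mulrA e (iota h)) iota_idem_l.
      by rewrite (mulrA (iota g) e) iota_idem_r.
    by rewrite E0 mulr0 mul0r.
  move=> z zKJ; move: t; apply: corner_ideal_ind => [|t u _ _ t0 u0|a h b hH].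
  - by rewrite mulr0.
  - by rewrite mulrDr t0 u0 addr0.
  rewrite !mulrA; apply: E => //.
  move: z zKJ; apply: ideal_mul_ind => [|y z y0 z0|y j yK jJ].
  - by rewrite mul0r ideal_mul0.
  - by rewrite mulrDl ideal_mulD.
  - by rewrite -mulrA mem_ideal_mul // (@idealMr _ (@jacobson A)).
- apply/projective_idealP.
  have [J [y [g [gB gM gf gK]]]] := corner_basis AS.
  have [L [x [F [FP eF]]]] := trace_basis AS.
  have [xK FB FM Ff FK] := FP.
  have FE := trace_coord FP eF; have FD i := morphB_inD (FB i).
  have F0 i := morphB_in0 (FB i).
  have al0 p := morphB_in0 (alB p).
  have i0 := zmod_morphism0 iB.
  (* [phi p] is [alpha p] tensored with the identity of [eA]; the left dual basis of [eA] stands in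
     for the tensor product over [S]. *)
  pose phi p c := fsum (fun j => iota (alpha p (g j c)) * y j).
  (* For [c] in [eA] this says that [c] lies in [iota(H) A], where [phi p] is additive. *)
  pose inH c := forall j, g j c \in H.
  have phi_fin p c : fin_supp (fun j => iota (alpha p (g j c)) * y j).
    apply: (fin_supp_map (h := fun j s => iota (alpha p s) * y j)) (gf c) => j.
    by rewrite al0 i0 mul0r.
  have phiB p c d : inH c -> inH d -> phi p (c - d) = phi p c - phi p d.
    move=> cH dH; rewrite /phi -fsumB //; apply: eq_fsum => j.
    by rewrite gB alB // iB mulrBl.
  have phiE p h b : h \in H -> phi p (iota h * b) = iota (alpha p h) * b.
    move=> hH; rewrite -(iota_idem_r (alpha p h)) -mulrA -gK -raddf_fsum.
    - by apply: eq_fsum => j; rewrite gM alM // iM mulrA.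
    - exact: mulrBr.
    apply: (fin_supp_map (h := fun j s => iota s * y j)) (gf b) => j.
    by rewrite i0 mul0r.
  have phi0 p : phi p 0 = 0.
    by rewrite -(mul0r (0 : A)) -i0 phiE ?(rpred0 H) // al0 i0 mul0r.
  have inHD c d : inH c -> inH d -> inH (c + d).
    by move=> cH dH j; rewrite (zmod_morphismD (gB j)) (@rpredD _ H).
  have FH i k : k \in K H -> inH (F i k).
    move: k; apply: corner_ideal_ind => [|k l /subK kK /subK lK kH lH|a h b hH] j.
    - by rewrite F0 (zmod_morphism0 (gB j)) (rpred0 H).
    - by rewrite FD //; apply: inHD.
    by rewrite FE gM; apply: (@idealMr _ H); apply: (@idealMl _ H).
  pose Phi i p k := phi p (F i k).
  have PhiB i p : {in K H &, {morph Phi i p : k l / k - l}}.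
    by move=> k l kK lK; rewrite /Phi FB ?subK // phiB //; apply: FH.
  have Phi0 i p : Phi i p 0 = 0 by rewrite /Phi F0 phi0.
  have PhiD i p := morphB_inD (PhiB i p).
  have PhiE i p a h b : h \in H ->
      Phi i p (a * iota h * b) = iota (alpha p (rho (F i (a * e)) * h)) * b.
    by move=> hH; rewrite /Phi FE phiE // (@idealMl _ H).
  (* On a generator a single argument of [alpha p] is involved, so [alf] gives the support; a sum of
     elements joins two supports. *)
  have Phi_fin i k : k \in K H -> fin_supp (fun p => Phi i p k).
    move: k; apply: corner_ideal_ind => [|k l kK lK [s ks] [t lt]|a h b hH].
    - by exists [::] => p _.
    - have [stk stl] := supported_cat ks lt; exists (s ++ t) => p p_st.
      by rewrite PhiD // stk // stl // addr0.
    have [|s hs] := alf (rho (F i (a * e)) * h); first exact: (@idealMl _ H).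
    by exists s => p /hs al_h; rewrite PhiE // al_h i0 mul0r.
  have Phi_sum i k : k \in K H -> fsum (fun p => iota (eta p) * Phi i p k) = F i k.
    have fin l : l \in K H -> fin_supp (fun p => iota (eta p) * Phi i p l).
      move=> lK; have := Phi_fin i l lK.
      apply: (fin_supp_map (h := fun p c => iota (eta p) * c)) => p.
      exact: mulr0.
    move: k; apply: corner_ideal_ind => [|k l kK lK ks ls|a h b hH].
    - by rewrite F0 -[RHS](@fsum0 P); apply: eq_fsum => p; rewrite Phi0 mulr0.
    - rewrite FD ?subK // -ks -ls -(fsumD (fin _ kK) (fin _ lK)); apply: eq_fsum => p.
      by rewrite PhiD // mulrDr.
    rewrite FE; set s := _ * h; have sH : s \in H by apply: (@idealMl _ H).
    have al_fin : fin_supp (fun p => eta p * alpha p s).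
      apply: (fin_supp_map (h := fun p t => eta p * t)) (alf s sH) => p.
      exact: mulr0.
    rewrite -[s in RHS]alK // -(raddf_fsum iB) // -(raddf_fsum (h := *%R^~ b)).
    - by apply: eq_fsum => p; rewrite PhiE // iM mulrA.
    - by move=> c d; rewrite mulrBl.
    by apply: (fin_supp_map (h := fun=> iota)) al_fin => p.
  exists (L * P)%type, (fun ip => x ip.1 * iota (eta ip.2)).
  exists (fun ip => Phi ip.1 ip.2).
  split=> [[i p]|[i p]|[i p] k a|k kK|k kK] /=.
  + by rewrite -[_ * iota _]mulr1 mem_corner_ideal.
  + exact: PhiB.
  + move=> kK; move: k kK a; apply: (@corner_ideal_ind _ _ iota H
      (fun k => forall a, Phi i p (k * a) = Phi i p k * a)).
    * by move=> a; rewrite mul0r Phi0 mul0r.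
    * move=> k l kK lK ka la a; rewrite mulrDl !PhiD ?ka ?la ?mulrDl //;
        exact: (@idealMr _ (K H)).
    by move=> a h b hH c; rewrite -mulrA !PhiE // mulrA.
  (* The support in the first index comes from [F] and serves every [p], because [phi p] vanishes at
     0. *)
  + apply: (@fin_supp_pair _ _ _ (fun i p => Phi i p k)) => [|i]; last exact: Phi_fin.
    have [s Fs] := Ff k (subK _ kK); exists s => i p /Fs Fi.
    by rewrite /Phi Fi phi0.
  rewrite (@fsum_pair _ _ _ (fun i p => x i * iota (eta p) * Phi i p k)).
  + rewrite -[RHS](FK _ (subK _ kK)); apply: eq_fsum => i.
    rewrite -(Phi_sum i k kK) -(raddf_fsum (mulrBr (x i))).
      by apply: eq_fsum => p; rewrite mulrA.
    apply: (fin_supp_map (h := fun p c => iota (eta p) * c)) (Phi_fin i k kK) => p.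
    exact: mulr0.
  + have [s Fs] := Ff k (subK _ kK); exists s => i p /Fs Fi.
    by rewrite /Phi Fi phi0 mulr0.
  move=> i; have := Phi_fin i k kK.
  apply: (fin_supp_map (h := fun p c => x i * iota (eta p) * c)) => p.
  exact: mulr0.
apply/idP/idP; first exact: ideal_mul_sub.
move: z; apply: corner_ideal_ind => [|y z _ _|a h b].
- exact: ideal_mul0.
- exact: ideal_mulD.
(* Idempotence makes [h] a sum of products from [H], and each resulting term splits as
   [(a * iota g * 1) * (1 * iota h * b)]. *)
rewrite -H2 => hHH; move: h hHH a b.
apply: ideal_mul_ind => [|g h g2 h2|g h gH hH] a b.
- by rewrite (zmod_morphism0 iB) mulr0 mul0r ideal_mul0.
- by rewrite iD mulrDr mulrDl ideal_mulD.
rewrite iM !mulrA -[_ * iota h * b]mulrA -[a * _]mulr1.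
rewrite mem_ideal_mul ?mem_corner_ideal //.
by rewrite -[iota h]mul1r mem_corner_ideal.
Qed.

End Stratifying.

(** * Passage to quotient rings *)

Lemma eq_quot_map (A : pzRingType) (I : tsideal A) (x y : A) :
  (quot_map I x == quot_map I y) = (x - y \in I).
Proof. by rewrite -subr_eq0 -rmorphB quot_map_eq0. Qed.

Lemma quot_map_repr (A : pzRingType) (I : tsideal A) (q : quot_ring I) :
  quot_map I (repr q) = q.
Proof. exact: reprK. Qed.


Definition quot_lift (A B : pzRingType) (I : tsideal A) (J : tsideal B)
  (f : A -> B) (q : quot_ring I) : quot_ring J := quot_map J (f (repr q)).
Arguments quot_lift {A B} I J f q.

Section QuotLift.
Variables (A B : pzRingType) (I : tsideal A) (J : tsideal B).

(** Compatibility is asked at the point [x] alone, because the trace coordinates are shown to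
    respect congruence only at elements of the trace ideal. *)
Lemma quot_liftE f x : (forall y, x - y \in I -> f x - f y \in J) ->
  quot_lift I J f (quot_map I x) = quot_map J (f x).
Proof.
move=> fIJ; apply/eqP; rewrite /quot_lift eq_sym eq_quot_map fIJ //.
by rewrite -eq_quot_map quot_map_repr.
Qed.

Lemma quot_lift_zmod f x : zmod_morphism f -> (forall y, y \in I -> f y \in J) ->
  quot_lift I J f (quot_map I x) = quot_map J (f x).
Proof. by move=> fB fIJ; apply: quot_liftE => y /fIJ; rewrite fB. Qed.

End QuotLift.

Section CornerQuotient.
Variables (A S : pzRingType) (iota : S -> A) (rho : A -> S) (H' : tsideal S).
Hypothesis AS : stratifying iota rho.
Local Notation e := (iota 1).
Local Notation K' := (corner_ideal iota H').
Local Notation pA := (quot_map K').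
Local Notation pS := (quot_map H').
Local Notation iotaQ := (quot_lift H' K' iota).
Local Notation rhoQ := (quot_lift K' H' rho).

Lemma quot_iotaE s : iotaQ (pS s) = pA (iota s).
Proof.
apply: quot_lift_zmod => [|h hH]; first exact: iotaB AS.
by rewrite -(iota_idem_l AS) -[_ * _]mulr1 mem_corner_ideal.
Qed.

Lemma quot_rhoE a : rhoQ (pA a) = pS (rho a).
Proof.
have rB := rhoB AS; apply: quot_lift_zmod => // k.
move: k; apply: corner_ideal_ind => [|x y _ _ xH yH|c h b hH].
- by rewrite (zmod_morphism0 rB) (rpred0 H').
- by rewrite (zmod_morphismD rB) (@rpredD _ H').
rewrite -[rho _]mul1r -(rho_iota_l AS) !mulrA (iota_rho_iota AS) (rho_iota_l AS).
by apply: (@idealMr _ H'); apply: (@idealMl _ H').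
Qed.

(** Generators map to generators and lift to generators. [H] and [HQ] stay abstract to cover both
    the trace ideal and the image of an ideal of [S]. *)
Lemma quot_corner_ideal (H : {pred S}) (HQ : {pred quot_ring H'}) :
    (forall h, h \in H -> pS h \in HQ) ->
    (forall q, q \in HQ -> exists2 h, h \in H & q = pS h) ->
  forall q, (q \in corner_ideal iotaQ HQ) <->
            (exists2 k, k \in corner_ideal iota H & q = pA k).
Proof.
move=> HHQ HQH q; split=> [|[k kH ->]]; last first.
  move: k kH; apply: corner_ideal_ind => [|x y _ _ xK yK|c h b hH].
  - by rewrite rmorph0 rpred0.
  - by rewrite rmorphD rpredD.
  - by rewrite !rmorphM /= -quot_iotaE mem_corner_ideal ?HHQ.
move: q; apply: corner_ideal_ind => [|_ _ _ _ [k kK ->] [l lK ->]|c q b /HQH[h hH ->]].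
- by exists 0; rewrite ?rmorph0 // (rpred0 (corner_ideal iota H)).
- by exists (k + l); rewrite ?rmorphD // (@rpredD _ (corner_ideal iota H)).
rewrite quot_iotaE; have [c' <-] := quot_map_surj c; have [b' <-] := quot_map_surj b.
by exists (c' * iota h * b'); rewrite ?rmorphM ?mem_corner_ideal.
Qed.

(** The values of [rho], [g j] and [F i] on [c * iota h * b] keep a factor [h], so these maps
    respect [K'] and [H'] and descend with their identities. *)
Lemma stratifying_quot : stratifying iotaQ rhoQ.
Proof.
have iB := iotaB AS; have rB := rhoB AS.
have e1 : iotaQ 1 = pA e by rewrite -(rmorph1 pS) quot_iotaE.
have KT : forall q, (q \in corner_ideal iotaQ predT) <->
    (exists2 k, k \in corner_ideal iota predT & q = pA k).
  by apply: quot_corner_ideal => // q _; have [s <-] := quot_map_surj q; exists s.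
have K'T : {subset K' <= corner_ideal iota predT} by apply: corner_idealS.
split.
- move=> q r; have [s <-] := quot_map_surj q; have [t <-] := quot_map_surj r.
  by rewrite -rmorphB !quot_iotaE iB rmorphB.
- move=> q r; have [s <-] := quot_map_surj q; have [t <-] := quot_map_surj r.
  by rewrite -rmorphM !quot_iotaE (iotaM AS) rmorphM.
- move=> q r; have [a <-] := quot_map_surj q; have [b <-] := quot_map_surj r.
  by rewrite -rmorphB !quot_rhoE rB rmorphB.
- by move=> q; have [s <-] := quot_map_surj q; rewrite quot_iotaE quot_rhoE (iotaK AS).
- move=> q; have [a <-] := quot_map_surj q.
  by rewrite quot_rhoE quot_iotaE (rhoK AS) e1 !rmorphM.
- have [J [y [g [gB gM gf gK]]]] := corner_basis AS.
  have gQE j a : quot_lift K' H' (g j) (pA a) = pS (g j a).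
    apply: quot_lift_zmod => // k; move: k.
    apply: corner_ideal_ind => [|k l _ _ kH lH|c h b hH].
    - by rewrite (zmod_morphism0 (gB j)) (rpred0 H').
    - by rewrite (zmod_morphismD (gB j)) (@rpredD _ H').
    rewrite -[g j _]mul1r -gM !mulrA (iota_rho_iota AS) gM.
    by apply: (@idealMr _ H'); apply: (@idealMl _ H').
  exists J, (fun j => pA (y j)), (fun j => quot_lift K' H' (g j)); split.
  + move=> j q r; have [a <-] := quot_map_surj q; have [b <-] := quot_map_surj r.
    by rewrite -rmorphB !gQE gB rmorphB.
  + move=> j q r; have [s <-] := quot_map_surj q; have [a <-] := quot_map_surj r.
    by rewrite quot_iotaE -rmorphM !gQE gM rmorphM.
  + move=> q; have [a <-] := quot_map_surj q; have [s sg] := gf a.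
    by exists s => j /sg gj; rewrite gQE gj rmorph0.
  move=> q; have [a <-] := quot_map_surj q.
  rewrite e1 -rmorphM -gK -(raddf_fsum (rmorphB pA)).
    by apply: eq_fsum => j; rewrite gQE quot_iotaE rmorphM.
  apply: (fin_supp_map (h := fun j s => iota s * y j)) (gf a) => j.
  by rewrite (zmod_morphism0 iB) mul0r.
have [L [x [F [FP eF]]]] := trace_basis AS.
have [xK FB FM Ff FK] := FP; have FE := trace_coord AS FP eF.
(* An element [l] congruent to [k] stays in the trace ideal, which contains [K']; so [F i] is
   additive on [k - l], and [trace_coord] keeps its value in [K']. *)
have FQE i k : k \in corner_ideal iota predT ->
    quot_lift K' K' (F i) (pA k) = pA (F i k).
  move=> kT; apply: quot_liftE => l klK'.
  have lT : l \in corner_ideal iota predT.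
    rewrite -[l](subKr k) (@rpredB _ (corner_ideal iota predT)) //; exact: K'T.
  rewrite -FB //; move: (k - l) klK'.
  apply: corner_ideal_ind => [|m n mK nK mF nF|c h b hH].
  - by rewrite (morphB_in0 (FB i)) (rpred0 K').
  - by rewrite (morphB_inD (FB i)) ?K'T // (@rpredD _ K').
  rewrite FE -[iota _]mul1r mem_corner_ideal //.
  exact: (@idealMl _ H').
exists L, (fun i => pA (x i)), (fun i => quot_lift K' K' (F i)).
split; last by move=> i q /KT[k kT ->]; rewrite FQE // e1 -rmorphM eF.
split=> [i|i q r|i q c|q|q].
- by apply/KT; exists (x i).
- move=> /KT[k kT ->] /KT[l lT ->]; rewrite -rmorphB !FQE ?FB ?rmorphB //.
  exact: (@rpredB _ (corner_ideal iota predT)).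
- move=> /KT[k kT ->]; have [a <-] := quot_map_surj c.
  rewrite -rmorphM !FQE ?FM ?rmorphM //.
  exact: (@idealMr _ (corner_ideal iota predT)).
- move=> /KT[k kT ->]; have [s sF] := Ff k kT.
  by exists s => i /sF Fi; rewrite FQE // Fi rmorph0.
move=> /KT[k kT ->]; rewrite -[in RHS](FK k kT) -(raddf_fsum (rmorphB pA)).
  by apply: eq_fsum => i; rewrite FQE // rmorphM.
by apply: (fin_supp_map (h := fun i c => x i * c)) (Ff k kT) => i; apply: mulr0.
Qed.

Lemma heredity_corner_quot (H : tsideal S) :
  heredity_ideal (quot_ideal H' H) ->
  heredity_ideal (quot_ideal K' (corner_ideal iota H)).
Proof.
move=> /(heredity_corner stratifying_quot); apply: heredity_ext => q.
have KE : (q \in corner_ideal iotaQ (quot_ideal H' H)) <->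
    (exists2 k, k \in corner_ideal iota H & q = pA k).
  by apply: quot_corner_ideal => [h hH|r /asboolP //]; apply/asboolP; exists h.
by apply/asboolP/idP => /KE.
Qed.

End CornerQuotient.

(** * The Morita ring *)

(** [f] induces an isomorphism from [A / I'] to [B / J'] that matches the two quotient ideals. *)
Lemma heredity_preim (A B : pzRingType) (f : {rmorphism A -> B})
    (J J' : tsideal B) (I I' : tsideal A) :
    (forall b, exists a, f a = b) ->
    (forall a, (a \in I) = (f a \in J)) -> (forall a, (a \in I') = (f a \in J')) ->
  heredity_ideal (quot_ideal J' J) -> heredity_ideal (quot_ideal I' I).
Proof.
move=> f_surj IJ IJ'; pose F := quot_lift I' J' f.
have FE a : F (quot_map I' a) = quot_map J' (f a).
  by apply: quot_lift_zmod => [|b]; [exact: rmorphB | rewrite IJ'].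
have F_inj : injective F.
  move=> q r; have [a <-] := quot_map_surj q; have [b <-] := quot_map_surj r.
  by rewrite !FE => /eqP; rewrite eq_quot_map -rmorphB -IJ' -eq_quot_map => /eqP.
have F_surj r : exists q, F q = r.
  have [b <-] := quot_map_surj r; have [a <-] := f_surj b.
  by exists (quot_map I' a).
have Fzmod : zmod_morphism F.
  move=> q r; have [a <-] := quot_map_surj q; have [b <-] := quot_map_surj r.
  by rewrite -rmorphB !FE !rmorphB.
have Fmonoid : monoid_morphism F.
  split=> [|q r]; first by rewrite -(rmorph1 (quot_map I')) FE !rmorph1.
  have [a <-] := quot_map_surj q; have [b <-] := quot_map_surj r.
  by rewrite -rmorphM !FE !rmorphM.
pose F' : {rmorphism quot_ring I' -> quot_ring J'} :=
  HB.pack F (GRing.isZmodMorphism.Build _ _ F Fzmod)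
    (GRing.isMonoidMorphism.Build _ _ F Fmonoid).
have [G GK] := choice F_surj.
have FK : cancel F G by move=> q; apply: F_inj; rewrite GK.
apply: (@heredity_iso _ _ F' G) => // q.
have [a <-] := quot_map_surj q; rewrite /= FE.
apply/asboolP/asboolP => -[h hI E].
  by exists (f h); [rewrite -IJ | rewrite -!FE E].
have [b fb] := f_surj h; exists b; first by rewrite IJ fb.
by apply: F_inj; rewrite !FE fb.
Qed.

Section FiniteSupportOption.
Variables (I : eqType) (V : zmodType) (G : option I -> V).
Hypothesis GS : fin_supp (G \o Some).

(** The index [None] will carry the idempotent [e], added to a dual basis of [M] or of [N]. *)
Lemma fin_supp_option : fin_supp G.
Proof.
have [s Gs] := GS; exists (None :: map Some s) => -[i|//].
by rewrite inE /= mem_map => [|? ? []] // /Gs.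
Qed.

Lemma fsum_option : fsum G = G None + fsum (G \o Some).
Proof.
have [s Gs] := GS; rewrite (fsumE Gs) (@fsumE _ _ (None :: map Some (undup s))).
  rewrite undup_id ?big_cons ?big_map //=.
  rewrite map_inj_uniq ?undup_uniq => [|? ? []] //; rewrite andbT.
  by apply/mapP => -[].
move=> [i|//]; rewrite inE /= mem_map => [|? ? []] //.
by rewrite mem_undup => /Gs.
Qed.

End FiniteSupportOption.

Section TensorFacts.
Variables (R S Q : pzRingType) (M : bimodType R S) (N : bimodType S Q).

Lemma tens0l (n : N) : tens (0 : M) n = 0.
Proof. by apply: (addrI (tens 0 n)); rewrite -tensDl !addr0. Qed.

Lemma tens0r (m : M) : tens m (0 : N) = 0.
Proof. by apply: (addrI (tens m 0)); rewrite -tensDr !addr0. Qed.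

Lemma tensNl (m : M) (n : N) : tens (- m) n = - tens m n.
Proof. by apply: (addrI (tens m n)); rewrite -tensDl !subrr tens0l. Qed.

Lemma tensBr (m : M) (n n' : N) : tens m (n - n') = tens m n - tens m n'.
Proof. by apply/eqP; rewrite eq_sym subr_eq -tensDr subrK. Qed.

Lemma ract0l (s : S) : (0 : M) *' s = 0.
Proof. by apply: (addrI (0 *' s)); rewrite -ractDl !addr0. Qed.

Lemma ract0r (m : M) : m *' 0 = 0.
Proof. by apply: (addrI (m *' 0)); rewrite -ractDr !addr0. Qed.

Lemma ractNl (m : M) s : (- m) *' s = - (m *' s).
Proof. by apply: (addrI (m *' s)); rewrite -ractDl !subrr ract0l. Qed.

Lemma tensor_ext (Z : zmodType) (f g : tensor M N -> Z) :
    zmod_morphism f -> zmod_morphism g ->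
  (forall m n, f (tens m n) = g (tens m n)) -> f =1 g.
Proof.
move=> fB gB fg; elim/tensor_ind => // [|t u ft fu].
  by rewrite !zmod_morphism0.
by rewrite fB gB ft fu.
Qed.

End TensorFacts.

Section MoritaStratifying.
Variables (R S : pzRingType) (M : bimodType R S) (N : bimodType S R).
Variable C : morita_context M N.
Local Notation L := (morita_ring C).
Local Notation phi := (mor_phi C).
Local Notation psi := (mor_psi C).

Definition morita_mx r m n s : L := ((r, m), (n, s)).

Definition morita_iota s : L := morita_mx 0 0 0 s.
Definition morita_rho (x : L) : S := x.2.2.
Local Notation iota := morita_iota.
Local Notation T := (corner_ideal iota predT).

Lemma morita_mxM r m n s r' m' n' s' :
  morita_mx r m n s * morita_mx r' m' n' s' =
  morita_mx (r * r' + phi (tens m n')) (r *: m' + m *' s')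
            (n *' r' + s *: n') (psi (tens n m') + s * s').
Proof. by []. Qed.

Lemma morita_mxE (x : L) : x = morita_mx x.1.1 x.1.2 x.2.1 x.2.2.
Proof. by case: x => [[? ?] [? ?]]. Qed.

Definition moritaM0 := (morita_mxM, tens0l, tens0r, ract0l, ract0r, mul0r, mulr0,
  scale0r, scaler0, raddf0, addr0, add0r, mul1r, mulr1, @ract1, scale1r).

(** [Le] is the second column and [eL] the second row: their products fill [M], [N] and [S], and
    leave sums of values of [phi] in the entry [R]. *)
Lemma morita_trace (x : L) : (x \in T) = (x.1.1 \in im_phi C).
Proof.
apply/idP/idP.
  move: x; apply: corner_ideal_ind => [|x y _ _|x h y _].
  - exact: (rpred0 (im_phi C)).
  - exact: (@rpredD _ (im_phi C)).
  rewrite [x]morita_mxE [y]morita_mxE /iota !moritaM0 /=.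
  by apply/asboolP; exists (tens (x.1.2 *' h) y.2.1).
move=> /asboolP[t xt]; rewrite [x]morita_mxE -xt.
have -> : morita_mx (phi t) x.1.2 x.2.1 x.2.2 =
    morita_mx (phi t) 0 0 0 + morita_mx 0 x.1.2 0 0 * iota 1 * 1
    + 1 * iota 1 * morita_mx 0 0 x.2.1 x.2.2.
  rewrite mulr1 mul1r /iota !moritaM0.
  by congr (_, _, (_, _)); rewrite /= ?addr0 ?add0r.
rewrite !rpredD ?mem_corner_ideal //; elim/tensor_ind: t {xt} => [|u v uT vT|m n].
- by rewrite raddf0 (rpred0 T).
- rewrite raddfB; have := @rpredB _ T _ _ uT vT.
  by congr (_ \in T); congr (_, _, (_, _)); rewrite subrr.
have -> : morita_mx (phi (tens m n)) 0 0 0 =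
    morita_mx 0 m 0 0 * iota 1 * morita_mx 0 0 n 0 by rewrite !moritaM0.
exact: mem_corner_ideal.
Qed.

Hypotheses (projM : projective_mod (rmod M)) (projN : projective_mod N).
Hypothesis phi_inj : injective phi.

(** As a left [S]-module [eL] is the direct sum of [N] and of a free summand generated by [e]. *)
Lemma morita_corner_basis : exists (J : eqType) (y : J -> L) (g : J -> L -> S),
    [/\ forall j, zmod_morphism (g j),
        forall j s a, g j (iota s * a) = s * g j a,
        forall a, fin_supp (g^~ a) &
        forall a, fsum (fun j => iota (g j a) * y j) = iota 1 * a].
Proof.
have [d [df dK]] := projective_dual_basis projN.
pose y (j : option N) := if j is Some n then morita_mx 0 0 n 0 else iota 1.
pose g (j : option N) (a : L) : S := if j is Some n then d n a.2.1 else a.2.2.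
exists (option N), y, g; split=> [[n|] a b|[n|] s a|a|a] //=.
- exact: raddfB.
- by rewrite [a]morita_mxE !moritaM0 /= linearZ.
- by rewrite [a]morita_mxE !moritaM0.
- by apply: fin_supp_option; apply: df.
have GE (n : N) : iota (d n a.2.1) * morita_mx 0 0 n 0 =
    morita_mx 0 0 (d n a.2.1 *: n) 0 by rewrite !moritaM0.
have [s ds] := df a.2.1.
rewrite fsum_option /=; last by exists s => n /ds /= dn; rewrite GE dn scale0r.
have hB : zmod_morphism (fun n : N => morita_mx 0 0 n 0).
  by move=> u v; congr (_, _, (_, _)); rewrite subrr.
under eq_fsum do rewrite /= GE.
rewrite (raddf_fsum hB) ?dK; last by exists s => n /ds->; rewrite scale0r.
rewrite [a in RHS]morita_mxE !moritaM0.
by congr (_, _, (_, _)); rewrite /= ?addr0 ?add0r.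
Qed.

(** By (d) this inverts [phi] on its image; elsewhere it takes the default value 0. *)
Let phi_inv (r : R) : tensor M N :=
  if pselect (exists t, phi t = r) is left tr then projT1 (cid tr) else 0.

Let phi_invK t : phi_inv (phi t) = t.
Proof.
rewrite /phi_inv; case: pselect => [?|[]]; last by exists t.
by case: cid => u /= /phi_inj.
Qed.

Section Coordinate.
Variable f : M -> S.
Hypotheses (fB : zmod_morphism f) (fM : forall m s, f (m *' s) = f m * s).

(** This is [f] tensored with the identity of [N], followed by the identification of [S] tensor [N]
    with [N]. *)
Definition tens_coord : tensor M N -> N := tensor_lift (fun m n => f m *: n).

Let coordDl (n : N) : {morph (fun m => f m *: n) : m m' / m + m'}.
Proof. by move=> m m'; rewrite (zmod_morphismD fB) scalerDl. Qed.
Let coordDr m : {morph (fun n : N => f m *: n) : n n' / n + n'}.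
Proof. by move=> n n'; rewrite scalerDr. Qed.
Let coordZ m s (n : N) : f (m *' s) *: n = f m *: (s *: n).
Proof. by rewrite fM scalerA. Qed.

Lemma tens_coordB : zmod_morphism tens_coord.
Proof. exact: tensor_lift_is_zmod_morphism. Qed.

Lemma tens_coordE m n : tens_coord (tens m n) = f m *: n.
Proof. exact: (tensor_lift_tens coordDl coordDr coordZ). Qed.

Lemma tens_coord_ract t r : tens_coord (t *' r) = tens_coord t *' r.
Proof.
move: t; apply: tensor_ext => [t u|t u|m n].
- by rewrite ractDl ractNl tens_coordB.
- by rewrite tens_coordB ractDl ractNl.
by rewrite tens_rscaleE !tens_coordE ractZ.
Qed.

(** By [mor_phiP], on a pure tensor [tens m' n] both sides equal [f m' * psi (tens n m)]. This makes
    the trace coordinates right linear against the [M] entries of [L]. *)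
Lemma tens_coord_psi t (m : M) :
  f ((phi t : R) *: m) = psi (tens (tens_coord t) m).
Proof.
move: t; apply: tensor_ext => [t u|t u|m' n].
- by rewrite raddfB scalerBl fB.
- by rewrite tens_coordB tensDl tensNl raddfB.
rewrite mor_phiP fM tens_coordE -tens_lscaleE.
by rewrite linearZ.
Qed.

End Coordinate.

(** As a right ideal [LeL] is the sum of its two rows. The lower row is [eL], generated by [e]; the
    upper one is, by injectivity of [phi], [M] tensored over [S] with [eL], so each coordinate of
    [M] extends to a map into [eL]. *)
Lemma morita_trace_basis : exists (I : eqType) (x : I -> L) (F : I -> L -> L),
  right_dual_basis T x F /\ forall i k, k \in T -> iota 1 * F i k = F i k.
Proof.
have [c [cf cK]] := projective_dual_basis projM.
have cB m : zmod_morphism (c m : M -> S) := raddfB (c m).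
have cM m (x : M) s : (c m (x *' s) : S) = (c m x : S) * s := linearZ_LR (c m) s x.
pose tc m := tens_coord (c m : M -> S).
have tcB m : zmod_morphism (tc m) := tens_coordB (cB m) (cM m).
have tcE m x n : tc m (tens x n) = (c m x : S) *: n :=
  tens_coordE (cB m) (cM m) x n.
have tcR m t r : tc m (t *' r) = tc m t *' r := tens_coord_ract (cB m) (cM m) t r.
have tcP m t (x : M) : (c m ((phi t : R) *: x) : S) = psi (tens (tc m t) x) :=
  tens_coord_psi (cB m) (cM m) t x.
pose x (i : option (rmod M)) :=
  if i is Some m then morita_mx 0 (m : M) 0 0 else iota 1.
pose F (i : option (rmod M)) (k : L) := if i is Some m then
  morita_mx 0 0 (tc m (phi_inv k.1.1)) (c m k.1.2 : S) else iota 1 * k.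
have TP k : k \in T -> exists t, k.1.1 = phi t.
  by rewrite morita_trace => /asboolP[t <-]; exists t.
have tf t : exists s : seq (rmod M), forall m, m \notin s -> tc m t = 0.
  elim/tensor_ind: t => [|t u [s st] [s' su]|m n].
  - by exists [::] => m _; rewrite zmod_morphism0.
  - exists (s ++ s') => m; rewrite mem_cat negb_or => /andP[/st t0 /su u0].
    by rewrite tcB t0 u0 subr0.
  - by have [s sc] := cf m; exists s => l /sc cl; rewrite tcE cl scale0r.
(* Balancedness moves the coordinates of the left factor back into [M], where they rebuild that
   factor. *)
have tK t : fsum (fun m : rmod M => tens (m : M) (tc m t)) = t.
  have fin u : fin_supp (fun m : rmod M => tens (m : M) (tc m u)).
    by have [s su] := tf u; exists s => m /su->; rewrite tens0r.
  move: t; apply: tensor_ext => [t u|//|m n].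
    rewrite -fsumB //; apply: eq_fsum => m.
    by rewrite tcB tensBr.
  have tB : zmod_morphism (fun y : rmod M => tens (y : M) n).
    by move=> y z; rewrite tensDl tensNl.
  rewrite -[X in _ = tens X n](cK m) -(raddf_fsum tB).
    by apply: eq_fsum => l; rewrite tcE -tensZ.
  by have [s sc] := cf m; exists s => l /sc->; rewrite scale0r.
exists (option (rmod M)), x, F; split; last first.
  by move=> [m|] k _ /=; rewrite ?mulrA !moritaM0.
split=> [[m|]|[m|] k l kT lT|[m|] k a kT|k kT|k kT].
- by rewrite morita_trace /= (rpred0 (im_phi C)).
- by rewrite morita_trace /= (rpred0 (im_phi C)).
- have [t kt] := TP k kT; have [u lu] := TP l lT; rewrite /F.
  have -> : (k - l).1.1 = phi (t - u) by rewrite [phi _]raddfB /= -kt -lu.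
  rewrite kt lu !phi_invK tcB; congr (_, _, (_, _)); rewrite ?subr0 //.
  exact: cB.
- exact: mulrBr.
- have [t kt] := TP k kT; rewrite /F.
  have -> : (k * a).1.1 = phi (t *' a.1.1 + tens k.1.2 a.2.1).
    by rewrite [phi _]raddfD /= bimod_funP -kt [k]morita_mxE [a]morita_mxE.
  have -> : (k * a).1.2 = (phi t : R) *: a.1.2 + k.1.2 *' a.2.2.
    by rewrite -kt [k]morita_mxE [a]morita_mxE.
  rewrite kt !phi_invK [a]morita_mxE !moritaM0 /= (zmod_morphismD (tcB m)).
  by rewrite tcR tcE (zmod_morphismD (cB m)) cM tcP.
- exact: mulrA.
- have [t kt] := TP k kT; have [s st] := tf t; have [s' sk] := cf k.1.2.
  apply: fin_supp_option; exists (s ++ s') => m.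
  rewrite mem_cat negb_or => /andP[/st t0 /sk k0].
  by rewrite /= kt phi_invK t0 k0.
have [t kt] := TP k kT; have [s st] := tf t; have [s' sk] := cf k.1.2.
(* The [G m] sum to the upper row of [k]; the term at [None] contributes [e * k], its lower row. *)
pose G m : L := morita_mx (phi (tens (m : M) (tc m t))) (m *' (c m k.1.2 : S)) 0 0.
have GE m : x (Some m) * F (Some m) k = G m by rewrite /= kt phi_invK !moritaM0.
have G_fin : fin_supp G.
  exists (s ++ s') => m; rewrite mem_cat negb_or => /andP[/st t0 /sk k0].
  by rewrite /G t0 k0 !moritaM0.
rewrite fsum_option; last by case: G_fin => r Gr; exists r => m /Gr; rewrite -GE.
rewrite (eq_fsum (G' := G)) //=.
have G11 : (fsum G).1.1 = k.1.1.
  rewrite -(raddf_fsum (h := fun y : L => y.1.1)) // kt /= -[in RHS](tK t).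
  rewrite -(raddf_fsum (raddfB phi)) //.
  by exists s => m /st->; rewrite tens0r.
have G12 : (fsum G).1.2 = k.1.2.
  by rewrite -(raddf_fsum (h := fun y : L => y.1.2)) //; apply: cK.
have G2 : (fsum G).2 = 0.
  rewrite -(raddf_fsum (h := fun y : L => y.2)) //; exact: fsum0.
rewrite [k in LHS]morita_mxE !moritaM0 [fsum G]morita_mxE G11 G12 G2.
by rewrite [RHS]morita_mxE; congr (_, _, (_, _)); rewrite /= ?addr0 ?add0r.
Qed.

Lemma morita_stratifying : stratifying morita_iota morita_rho.
Proof.
split=> [s t|s t|x y|s|x||] //.
- by congr (_, _, (_, _)); rewrite subrr.
- by rewrite !moritaM0.
- by rewrite [x]morita_mxE !moritaM0.
- exact: morita_corner_basis.
- exact: morita_trace_basis.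
Qed.

End MoritaStratifying.

(** * The quotient by the trace ideal and the combined heredity chain *)

Section PreimageIdeal.
Variables (A B : pzRingType) (f : {rmorphism A -> B}) (J : tsideal B).

Definition preim_ideal : {pred A} := fun x => f x \in J.

Fact preim_ideal_zmod_closed : zmod_closed preim_ideal.
Proof.
split=> [|x y xJ yJ]; rewrite unfold_in /preim_ideal.
  by rewrite rmorph0 (rpred0 J).
by rewrite rmorphB (@rpredB _ J).
Qed.

Fact preim_ideal_two_sided : two_sided preim_ideal.
Proof.
by move=> a x xJ; split; rewrite unfold_in /preim_ideal rmorphM;
  [apply: (@idealMl _ J) | apply: (@idealMr _ J)].
Qed.

HB.instance Definition _ :=
  GRing.isZmodClosed.Build A preim_ideal preim_ideal_zmod_closed.
HB.instance Definition _ := isTwoSided.Build A preim_ideal preim_ideal_two_sided.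

End PreimageIdeal.

Section MoritaQuotient.
Variables (R S : pzRingType) (M : bimodType R S) (N : bimodType S R).
Variable C : morita_context M N.

Definition morita_quot (x : morita_ring C) : quot_ring (im_phi C) :=
  quot_map (im_phi C) x.1.1.

Fact morita_quot_zmod : zmod_morphism morita_quot.
Proof. by move=> x y; rewrite /morita_quot -rmorphB. Qed.

(** The [R] entry of a product differs from the product of the [R] entries by a value of [phi]. *)
Fact morita_quot_monoid : monoid_morphism morita_quot.
Proof.
split=> [|x y]; first exact: rmorph1.
rewrite [x]morita_mxE [y]morita_mxE morita_mxM /morita_quot /= -rmorphM.
apply/eqP; rewrite eq_quot_map addrAC subrr add0r.
by apply/asboolP; exists (tens x.1.2 y.2.1).
Qed.

HB.instance Definition _ := GRing.isZmodMorphism.Build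
  (morita_ring C) (quot_ring (im_phi C)) morita_quot morita_quot_zmod.
HB.instance Definition _ := GRing.isMonoidMorphism.Build
  (morita_ring C) (quot_ring (im_phi C)) morita_quot morita_quot_monoid.

Lemma morita_quot_surj q : exists x, morita_quot x = q.
Proof.
have [r <-] := quot_map_surj q; by exists (morita_mx C r 0 0 0).
Qed.

End MoritaQuotient.

Theorem theorem1p1 (R S : pzRingType) (M : bimodType R S) (N : bimodType S R)
    (C : morita_context M N) :
  semiprimary (morita_ring C) ->
  quasi_hereditary (quot_ring (im_phi C)) ->
  quasi_hereditary S ->
  projective_mod (rmod M) ->
  projective_mod N ->
  injective (mor_phi C) ->
  quasi_hereditary (morita_ring C).
Proof.
move=> semiL [_ [m [G [G0 Gm Gchain]]]] [_ [n [H [H0 Hn Hchain]]]].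
move=> projM projN phi_inj.
split=> //.
have LS := morita_stratifying projM projN phi_inj.
pose pi : {rmorphism _ -> _} := @morita_quot _ _ _ _ C.
(* The ideals before index [m] are pulled back from [R / Im phi]; from [m] on, the chain of [S],
   shifted by [m], generates them. *)
pose K i : tsideal (morita_ring C) :=
  if (i < m)%N then (preim_ideal pi (G i) : tsideal _)
  else (corner_ideal (morita_iota C) (H (i - m)%N) : tsideal _).
(* Both descriptions of [K m] are the trace ideal [LeL]. *)
have KE i : (i <= m)%N -> forall x, (x \in K i) = (pi x \in G i).
  rewrite leq_eqVlt /K => /orP[/eqP->|-> //] x; rewrite ltnn subnn.
  rewrite Gm inE /= /morita_quot quot_map_eq0 -morita_trace.
  by apply/idP/idP; apply: corner_idealS => s; rewrite H0.
exists (m + n)%N, K; split=> [x|x|i i_mn].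
- by rewrite KE // G0.
- rewrite /K ltnNge leq_addr addKn /= inE.
  apply/idP/eqP => [|->]; last exact: (rpred0 (corner_ideal (morita_iota C) (H n))).
  move: x; apply: corner_ideal_ind => [//|x y _ _ -> ->|a h b].
    by rewrite addr0.
  rewrite Hn inE => /eqP->.
  by rewrite (zmod_morphism0 (iotaB LS)) mulr0 mul0r.
(* When [i.+1 = m] the lower ideal is [K m]; [KE] presents it too as a preimage, so every factor
   above [LeL] comes from the quotient ring. *)
have [i_m|m_i] := ltnP i m.
  have [subG herG] := Gchain i i_m; split.
    by move=> x; rewrite !KE // ?(ltnW i_m) //; apply: subG.
  by apply: (heredity_preim (f := pi)) herG => [q|x|x]; rewrite ?KE ?(ltnW i_m) //;
    apply: morita_quot_surj.
have := Hchain (i - m)%N; rewrite ltn_subLR // => /(_ i_mn)[subH herH].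
have -> : K i = corner_ideal (morita_iota C) (H (i - m)%N) by rewrite /K ltnNge m_i.
have -> : K i.+1 = corner_ideal (morita_iota C) (H (i - m).+1).
  by rewrite /K ltnNge leqW // subSn.
split; first exact: corner_idealS.
exact: (heredity_corner_quot LS).
Qed.
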